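(* For every real $C>\frac12$ there exists a non-trivial (i.e. not identically zero) function $u \in H^1(\mathbb{R}^2;\mathbb{C}^2)\cap C^\infty(\mathbb{R}^2\setminus\{0\};\mathbb{C}^2)$ which vanishes at infinite order at the origin, that is $$\lim_{R\to 0}\frac{1}{R^k}\int_{\{|x|<R\}}|u(x)|^2\,dx=0\quad\text{for all }k\in\mathbb{N},$$ and which satisfies $$|\mathcal{D}_2u(x)|\le\frac{C}{|x|}\,|u(x)|\quad\text{for all }x\in\mathbb{R}^2\setminus\{0\}.$$
   Context: $|\cdot|$ denotes the Euclidean norm on $\mathbb{R}^2$ and on $\mathbb{C}^2$. $\mathcal{D}_2$ is the two-dimensional massless Dirac operator, acting on functions $\psi:\mathbb{R}^2\to\mathbb{C}^2$ by $\mathcal{D}_2\psi:=-i\sigma_1\partial_1\psi-i\sigma_2\partial_2\psi$, where $\sigma_1=\begin{pmatrix}0&1\\1&0\end{pmatrix}$ and $\sigma_2=\begin{pmatrix}0&-i\\i&0\end{pmatrix}$ are Pauli matrices. Equivalently, identifying $(x_1,x_2)$ with $z=x_1+ix_2$, $\mathcal{D}_2=\begin{pmatrix}0&-2i\partial_z\\-2i\partial_{\bar z}&0\end{pmatrix}$ with $2\partial_z=\partial_1-i\partial_2$ and $2\partial_{\bar z}=\partial_1+i\partial_2$. *)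

(* Defs.v *)
From HB Require Import structures.
From mathcomp Require Import all_boot all_order all_algebra.
From mathcomp Require Import all_classical all_reals all_analysis.
From mathcomp.real_closed Require Import complex.
Set Implicit Arguments.
Unset Strict Implicit.
Unset Printing Implicit Defensive.
Import Order.TTheory GRing.Theory Num.Theory.
Import numFieldNormedType.Exports.
Local Open Scope classical_set_scope.
Local Open Scope ring_scope.
Local Open Scope complex_scope.

Section Dirac.
Context {R : realType}.

(* The plane is [R * R]. The norm that the library puts on this type is the
   sup norm, hence the separate Euclidean norm. It induces the same topology,
   so the library's limits, derivatives and compactness apply unchanged. *)
Definition norm_R2 (x : R * R) : R := Num.sqrt (x.1 ^+ 2 + x.2 ^+ 2).

Definition norm_C2 (z : 'cV[R[i]]_2) : R :=
  Num.sqrt (\sum_j (complex.Re (z j 0) ^+ 2 + complex.Im (z j 0) ^+ 2)).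

Definition lebesgue2 :
    {measure set (measurableTypeR R * measurableTypeR R) -> \bar R} :=
  (@lebesgue_measure R \x @lebesgue_measure R)%E.

Definition basis_vec (k : 'I_2) : R * R := if k == 0 then (1, 0) else (0, 1).

Definition iter_partial (s : seq 'I_2) (f : R * R -> R) : R * R -> R :=
  foldr (fun k g x => 'D_(basis_vec k) g x) f s.

(* [D] is meant to be open. *)
Definition smooth_on (D : set (R * R)) (f : R * R -> R) : Prop :=
  forall (s : seq 'I_2) (x : R * R), D x ->
    {for x, continuous (iter_partial s f)} /\
    forall k : 'I_2, derivable (iter_partial s f) x (basis_vec k).

Definition test_function (phi : R * R -> R) : Prop :=
  smooth_on setT phi /\ compact (closure [set x | phi x != 0]).

Definition weak_partial (k : 'I_2) (f g : R * R -> R) : Prop :=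
  forall phi : R * R -> R, test_function phi ->
    \int[lebesgue2]_x (f x * 'D_(basis_vec k) phi x) =
    - \int[lebesgue2]_x (g x * phi x).

Definition sobolev_H1 (f : R * R -> R) : Prop :=
  f \in Lfun lebesgue2 2%:E /\
  forall k : 'I_2, exists2 g : R * R -> R,
    g \in Lfun lebesgue2 2%:E & weak_partial k f g.

(* The regularity classes of C^2-valued functions are taken componentwise, on
   real and imaginary parts. *)
Definition componentwise (P : (R * R -> R) -> Prop)
    (u : R * R -> 'cV[R[i]]_2) : Prop :=
  forall j : 'I_2,
    P (fun x => complex.Re (u x j 0)) /\ P (fun x => complex.Im (u x j 0)).

Definition sobolev_H1_C2 := componentwise sobolev_H1.

Definition smooth_on_C2 (D : set (R * R)) := componentwise (smooth_on D).

Definition partial_C2 (k : 'I_2) (u : R * R -> 'cV[R[i]]_2) (x : R * R) :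
    'cV[R[i]]_2 :=
  \col_j ('D_(basis_vec k) (fun y => complex.Re (u y j 0)) x
          +i* 'D_(basis_vec k) (fun y => complex.Im (u y j 0)) x).

Definition sigma1 : 'M[R[i]]_2 :=
  \matrix_(i, j) nth 0 (nth [::] [:: [:: 0; 1];
                                     [:: 1; 0]] i) j.

Definition sigma2 : 'M[R[i]]_2 :=
  \matrix_(i, j) nth 0 (nth [::] [:: [:: 0;    - 'i%C];
                                     [:: 'i%C; 0      ]] i) j.

Definition dirac2 (u : R * R -> 'cV[R[i]]_2) (x : R * R) : 'cV[R[i]]_2 :=
  - ('i%C *: (sigma1 *m partial_C2 0 u x))
  - 'i%C *: (sigma2 *m partial_C2 1 u x).

Definition vanishes_infinite_order (u : R * R -> 'cV[R[i]]_2) : Prop :=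
  forall k : nat,
    ((r ^- k)%:E *
      \int[lebesgue2]_(x in [set x | (norm_R2 x < r)%R])
        (norm_C2 (u x) ^+ 2)%:E)%E
    @[r --> 0^'+] --> 0%E.

End Dirac.

(* Main.v *)
Require Import Defs.
From mathcomp Require Import all_boot all_order all_algebra.
From mathcomp Require Import all_classical all_reals all_analysis.
From mathcomp.real_closed Require Import complex.
From mathcomp Require Import measurable_realfun ring lra zify.
Import Order.TTheory GRing.Theory Num.Theory.
Import numFieldNormedType.Exports.
Local Open Scope classical_set_scope.
Local Open Scope ring_scope.

(* In the coordinate [z = e^(t + i theta)], the operator [|x| D_2] acts on the
   components of [u] as [d/dt + i d/dtheta] and [d/dt - i d/dtheta], up to a
   unimodular factor. So [u_1 = A(t) e^(i m theta)] and
   [u_2 = A(t) e^(- i m theta)] both contribute [|A' - m A|], and the two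
   components do not interact. Take [A_m(t) = e^(rho(t)) chi(s(t) - m)] with
   [rho(t) = - lam t^2 / 2] and [s = rho' = - lam t], where [chi] is a smooth
   bump supported in [[-a, a]], [1/2 < a < min(C, 1)]. Where [A_m] is nonzero,
   the growth rate [s] is within [a] of [m], so the only loss comes from
   [lam chi'] and is absorbed by [C > a] for [lam] small, because [a > 1/2]
   makes the supports of the [A_m] overlap. Even modes go into [u_1] and odd
   modes into [u_2]: as [a < 1], two modes of one component are never alive
   together. Since [|u| <= e^(- lam (ln |x|)^2 / 2)], all moments of [u] and of
   its gradient are finite at the origin and at infinity. *)

(** * Functions of class C^n on an open set *)

Section Ck.
Set Implicit Arguments.
Unset Strict Implicit.
Context {R : realType}.
Implicit Types (D : set (R * R)) (f g : R * R -> R) (k : 'I_2) (x v : R * R).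

(** Restriction to the line through [x] in direction [v] makes the one-variable chain rule available
    for directional derivatives, with no total differentiability of [f]. *)
Lemma is_derive_lineP f x v (df : R) :
  is_derive x v f df <->
  is_derive (0 : R) (1 : R) (fun r : R => f (r *: v + x)) df.
Proof.
have E : 'D_1 (fun r : R => f (r *: v + x)) 0 = 'D_v f x.
  rewrite /derive; set g1 := fun h => h^-1 *: _; set g2 := fun h => h^-1 *: _.
  suff -> : g1 = g2 by [].
  by apply/funext => r; rewrite /g1 /g2 /= addr0 scale0r add0r [_%:A]mulr1.
split=> -[Df <-].
  by split=> //; exact: (derivable1P f x v).1.
by split=> //; exact: (derivable1P f x v).2.
Qed.

Lemma is_derive_comp_dir (h : R -> R) f x v (dh df : R) :
  is_derive (f x) (1 : R) h dh -> is_derive x v f df ->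
  is_derive x v (fun y => h (f y)) (dh * df).
Proof.
move=> Dh /is_derive_lineP Df; apply/is_derive_lineP.
apply: (@is_derive1_comp _ h (fun r : R => f (r *: v + x))) => //.
by rewrite scale0r add0r.
Qed.

Lemma is_derive_fst x v : is_derive x v (fun y : R * R => y.1) v.1.
Proof.
apply/is_derive_lineP.
have : is_derive (0 : R) (1 : R) (fun r : R => r * v.1 + x.1) (v.1).
  by apply: is_derive_eq; rewrite /GRing.scale /=; ring.
by [].
Qed.

Lemma is_derive_snd x v : is_derive x v (fun y : R * R => y.2) v.2.
Proof.
apply/is_derive_lineP.
have : is_derive (0 : R) (1 : R) (fun r : R => r * v.2 + x.2) (v.2).
  by apply: is_derive_eq; rewrite /GRing.scale /=; ring.
by [].
Qed.

(** Recursion on the order, instead of words of partial derivatives as in [smooth_on], suits sums,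
    products and compositions: their derivatives are expressions in functions of lower order, to
    which the induction applies. *)
Fixpoint ck_on D n f : Prop :=
  (forall x, D x -> {for x, continuous f}) /\
  if n is n'.+1 then
    forall k, (forall x, D x -> derivable f x (basis_vec k)) /\
              ck_on D n' (fun x => 'D_(basis_vec k) f x)
  else True.

Lemma ck_on_continuous D n f :
  ck_on D n f -> forall x, D x -> {for x, continuous f}.
Proof. by case: n => [|n] []. Qed.

Lemma ck_onW D n f : ck_on D n.+1 f -> ck_on D n f.
Proof.
elim: n f => [|n IHn] f [cf df]; split=> // k.
by have [? ?] := df k; split=> //; exact: IHn.
Qed.

Lemma ck_on_smooth D f : (forall n, ck_on D n f) -> smooth_on D f.
Proof.
move=> ckf s x Dx.
have cks n : ck_on D n (iter_partial s f).
  elim: s n => [|k s IHs] n; first exact: ckf.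
  by have [_ /(_ k)[]] := IHs n.+1.
split; first exact: ck_on_continuous (cks 0%N) x Dx.
by move=> k; have [_ /(_ k)[+ _]] := cks 1%N; exact.
Qed.

(** The comparison function [g] may change with the point. This serves for [wave], whose formula
    changes from one ring around the origin to the next. *)
Lemma ck_on_local D n f :
  (forall x, D x -> exists2 g, ck_on D n g & \near x, f x = g x) ->
  ck_on D n f.
Proof.
have cont m f' : (forall x, D x -> exists2 g, ck_on D m g & \near x, f' x = g x)
    -> forall x, D x -> {for x, continuous f'}.
  move=> loc x Dx; have [g cg fg] := loc x Dx.
  have /= fgx := nbhs_singleton fg; rewrite /prop_for /continuous_at fgx.
  apply: cvg_trans (ck_on_continuous cg Dx : _ --> _).
  by apply: near_eq_cvg; near do apply/esym.
elim: n f => [|n IHn] f loc; (split; first exact: cont loc) => //.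
move=> k; split => [x Dx|].
  have [g [_ /(_ k)[dg _]] fg] := loc x Dx.
  apply: near_eq_derivable (dg _ Dx).
  by near do apply/esym.
apply: IHn => x /loc[g [_ /(_ k)[_ ckg]] fg].
exists ('D_(basis_vec k) g) => //.
(* Equality near [x] is also equality near every [y] close to [x], so the derivatives agree on a
   neighbourhood of [x]. *)
near=> y; apply: near_eq_derive.
by near: y; apply: (near_join fg).
Unshelve. all: by end_near. Qed.

Lemma ck_on_eq D n f g : open D -> {in D, f =1 g} -> ck_on D n f -> ck_on D n g.
Proof.
move=> oD fg cf; apply: ck_on_local => x Dx; exists f => //.
have := open_nbhs_nbhs (conj oD Dx); apply: filterS => y Dy.
by rewrite fg// inE.
Qed.

Lemma ck_on_step D n f (df : 'I_2 -> R * R -> R) : open D ->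
  (forall x, D x -> {for x, continuous f}) ->
  (forall k x, D x -> is_derive x (basis_vec k) f (df k x)) ->
  (forall k, ck_on D n (df k)) -> ck_on D n.+1 f.
Proof.
move=> oD cf Df cdf; split=> // k; split=> [x /(Df k)[]//|].
apply: ck_on_eq (cdf k) => // x /[!inE] Dx.
by rewrite (@derive_val _ _ _ _ _ _ _ (Df k x Dx)).
Qed.

Lemma ck_on_cst D n (c : R) : open D -> ck_on D n (cst c).
Proof.
move=> oD; elim: n c => [|n IHn] c.
  by split=> // x _; exact: cst_continuous.
apply: (@ck_on_step _ _ _ (fun=> cst 0)) => // x _; exact: cst_continuous.
Qed.

Lemma continuous_fstR : continuous (fun y : R * R => y.1).
Proof. by move=> [a b]; apply: cvg_fst. Qed.

Lemma continuous_sndR : continuous (fun y : R * R => y.2).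
Proof. by move=> [a b]; apply: cvg_snd. Qed.

Lemma ck_on_fst_snd D n : open D ->
  ck_on D n (fun y => y.1) /\ ck_on D n (fun y => y.2).
Proof.
move=> oD; split; case: n => [|n].
- by split=> [x _|//]; exact: continuous_fstR.
- apply: (@ck_on_step _ _ _ (fun k => cst (basis_vec k).1)) => [//|x _|k x _|k].
  + exact: continuous_fstR.
  + exact: is_derive_fst.
  + exact: ck_on_cst.
- by split=> [x _|//]; exact: continuous_sndR.
- apply: (@ck_on_step _ _ _ (fun k => cst (basis_vec k).2)) => [//|x _|k x _|k].
  + exact: continuous_sndR.
  + exact: is_derive_snd.
  + exact: ck_on_cst.
Qed.

Lemma ck_on_partial D n f k : ck_on D n.+1 f -> forall x, D x ->
  is_derive x (basis_vec k) f ('D_(basis_vec k) f x).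
Proof. by move=> [_ /(_ k)[df _]] x /df; exact: derivableP. Qed.

Lemma ck_onD D n f g : open D ->
  ck_on D n f -> ck_on D n g -> ck_on D n (fun x => f x + g x).
Proof.
move=> oD; elim: n f g => [|n IHn] f g cf cg.
  split=> // x Dx.
  exact: (continuousD (ck_on_continuous cf Dx) (ck_on_continuous cg Dx)).
apply: (@ck_on_step _ _ _
    (fun k x => 'D_(basis_vec k) f x + 'D_(basis_vec k) g x)) => //.
- move=> x Dx.
  exact: (continuousD (ck_on_continuous cf Dx) (ck_on_continuous cg Dx)).
- move=> k x Dx; apply: is_deriveD.
    exact: ck_on_partial cf _ Dx.
  exact: ck_on_partial cg _ Dx.
- by move=> k; apply: IHn; [case: cf|case: cg] => _ /(_ k)[].
Qed.

Lemma ck_onM D n f g : open D ->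
  ck_on D n f -> ck_on D n g -> ck_on D n (fun x => f x * g x).
Proof.
move=> oD; elim: n f g => [|n IHn] f g cf cg.
  split=> // x Dx.
  exact: (continuousM (ck_on_continuous cf Dx) (ck_on_continuous cg Dx)).
apply: (@ck_on_step _ _ _
    (fun k x => f x * 'D_(basis_vec k) g x + g x * 'D_(basis_vec k) f x)) => //.
- move=> x Dx.
  exact: (continuousM (ck_on_continuous cf Dx) (ck_on_continuous cg Dx)).
- move=> k x Dx; apply: is_deriveM.
    exact: ck_on_partial cf _ Dx.
  exact: ck_on_partial cg _ Dx.
- have [[_ cf'] [_ cg']] := (cf, cg) => k.
  apply: ck_onD => //; apply: IHn; first exact: ck_onW.
  + by have [_] := cg' k.
  + exact: ck_onW.
  + by have [_] := cf' k.
Qed.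

Lemma ck_onZ D n (c : R) f : open D -> ck_on D n f -> ck_on D n (fun x => c * f x).
Proof. by move=> oD; apply: ck_onM => //; exact: ck_on_cst. Qed.

(** A class of one-variable functions closed under differentiation consists of smooth functions;
    quantifying over the whole class lets the induction pass from [h] to [h']. *)
Lemma ck_on_comp (P : (R -> R) -> Prop) :
  (forall h, P h -> exists2 h', P h' & forall y, is_derive y (1 : R) h (h' y)) ->
  forall D n h f, open D -> P h -> ck_on D n f -> ck_on D n (fun x => h (f x)).
Proof.
move=> closedP D n h f oD; elim: n h => [|n IHn] h Ph cf;
    have [h' Ph' Dh] := closedP _ Ph.
  split=> // x Dx; apply: continuous_comp; first exact: ck_on_continuous cf _ Dx.
  apply/differentiable_continuous/derivable1_diffP.
  by have [] := Dh (f x).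
apply: (@ck_on_step _ _ _
    (fun k x => h' (f x) * 'D_(basis_vec k) f x)) => //.
- move=> x Dx; apply: continuous_comp; first exact: ck_on_continuous cf _ Dx.
  apply/differentiable_continuous/derivable1_diffP.
  by have [] := Dh (f x).
- move=> k x Dx; apply: is_derive_comp_dir => //.
  exact: ck_on_partial cf _ Dx.
- move=> k; apply: ck_onM => //; first by apply: IHn => //; exact: ck_onW.
  by have [_ /(_ k)[]] := cf.
Qed.

Lemma ck_on_expR D n f : open D -> ck_on D n f -> ck_on D n (fun x => expR (f x)).
Proof.
move=> oD; apply: (@ck_on_comp (eq^~ expR)) => // h ->.
by exists expR => // y; exact: is_derive_expR.
Qed.

End Ck.

(** * Flat functions *)

Section Flat.
Set Implicit Arguments.
Unset Strict Implicit.
Context {R : realType}.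
Implicit Types (q : {poly R}) (x y : R).

(** The difference quotient at [a] is at most [|K| |h|]. Used for [flat] at [0] and, along lines,
    for the solution at the origin. *)
Lemma is_derive_sqr_bound (f : R -> R) (a K : R) : f a = 0 ->
  (forall y, `|f y| <= K * (y - a) ^+ 2) -> is_derive a (1 : R) f 0.
Proof.
move=> fa fK.
have L : (fun h : R => h^-1 *: ((f \o shift a) (h *: (1 : R)) - f a)) @ (0 : R)^'
    --> (0 : R).
  apply/cvgr0Pnorm_lt => e e0.
  near=> h.
  have h0 : h != 0 by near: h; exact: nbhs_dnbhs_neq.
  have K0 : 0 <= `|K| by [].
  rewrite /= fa subr0 [_%:A]mulr1 normrM normfV mulrC ltr_pdivrMr ?normr_gt0//.
  rewrite (le_lt_trans (fK _))// addrK.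
  have -> : h ^+ 2 = `|h| * `|h| by rewrite -normrM ger0_norm -?expr2// sqr_ge0.
  rewrite mulrA ltr_pM2r ?normr_gt0//.
  have : `|K| * `|h| <= (`|K| + 1) * `|h| by rewrite ler_wpM2r// lerDl.
  move=> /le_lt_trans H; apply: le_lt_trans (H e _).
    by rewrite ler_wpM2r// ler_norm.
  rewrite -ltr_pdivlMl ?ltr_wpDl//.
  near: h; apply: dnbhs0_lt; rewrite mulr_gt0// invr_gt0 ltr_wpDl//.
by split; [apply/cvg_ex; exists 0|apply/cvg_lim].
Unshelve. all: by end_near. Qed.

Lemma exprn_expRN_le n x : 0 <= x -> x ^+ n * expR (- x) <= n`!%:R.
Proof.
move=> x0; rewrite expRN ler_pdivrMr ?expR_gt0//.
case: n => [|n]; first by rewrite expr0 fact0 mul1r -expR0 ler_expR.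
rewrite mulrC -ler_pdivrMr ?ltr0n ?fact_gt0//.
by apply: le_trans (expR_ge1Dxn n x0); rewrite lerDr.
Qed.

Lemma poly_expRN_bounded q :
  exists K, forall x, 0 <= x -> `|q.[x]| * expR (- x) <= K.
Proof.
(* The extra factor [x^n] carries the induction on [q]: it absorbs the [X] of [q X + c]. *)
suff H : forall n, exists K, forall x, 0 <= x ->
    x ^+ n * (`|q.[x]| * expR (- x)) <= K.
  have [K HK] := H 0%N; exists K => x x0.
  by rewrite -[leLHS]mul1r -(expr0 x) HK.
elim/poly_ind: q => [|q c IH] n.
  by exists 0 => x x0; rewrite horner0 normr0 mul0r mulr0.
have [K HK] := IH n.+1; exists (K + `|c| * n`!%:R) => x x0.
rewrite hornerMXaddC mulrCA.
have /le_trans -> // : `|q.[x] * x + c| * (x ^+ n * expR (- x)) <=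
    (`|q.[x]| * x + `|c|) * (x ^+ n * expR (- x)).
  rewrite ler_wpM2r ?mulr_ge0 ?exprn_ge0 ?expR_ge0//.
  by rewrite (le_trans (ler_normD _ _))// lerD2r normrM (ger0_norm x0).
rewrite mulrDl lerD//.
  apply: le_trans (HK x x0); rewrite exprS !mulrA le_eqVlt.
  by apply/orP; left; apply/eqP; ring.
by rewrite ler_wpM2l ?exprn_expRN_le.
Qed.

(* For polynomial [q] these functions are closed under differentiation, which
   gives their smoothness at [0] from [is_derive_sqr_bound] alone. *)
Definition flat q y : R := if 0 < y then q.[y^-1] * expR (- y^-1) else 0.

Lemma flat_bounded q : exists K, forall y, `|flat q y| <= K.
Proof.
have [K HK] := poly_expRN_bounded q; exists K => y; rewrite /flat.
case: ifPn => [y0|_]; last first.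
  by rewrite normr0 (le_trans _ (HK 0 _))// mulr_ge0 ?expR_ge0.
by rewrite normrM (ger0_norm (expR_ge0 _)) HK// invr_ge0 ltW.
Qed.

(** Since [flat (q * 'X^2)] is bounded too, this gives the quadratic bound at [0] that
    [is_derive_sqr_bound] requires. *)
Lemma flat_sqr q y : flat q y = y ^+ 2 * flat (q * 'X^2) y.
Proof.
rewrite /flat; case: ifPn => [y0|_]; last by rewrite mulr0.
by rewrite hornerM hornerXn; field; rewrite gt_eqF.
Qed.

(** For [y > 0] the derivative of [q(1/y) e^(-1/y)] is [(q - q')(1/y) e^(-1/y) / y^2]; for [y < 0]
    the function is locally zero; at [0] it is quadratically small. *)
Lemma is_derive_flat q y :
  is_derive y (1 : R) (flat q) (flat ((q - q^`()) * 'X^2) y).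
Proof.
have [y0|y0|->] := ltrgt0P y.
- have y_neq0 : y != 0 by rewrite gt_eqF.
  apply: (@near_eq_is_derive _ _ _ (fun z : R => q.[z^-1] * expR (- z^-1))).
    near=> z; rewrite /flat ifT//; near: z; exact: lt_nbhsr.
  have Dv : is_derive y (1 : R) (fun z : R => z^-1) (- y ^- 2).
    split; first exact: derivableV.
    by rewrite (@deriveV _ _ id)// derive_id /GRing.scale /= mulr1.
  have De : is_derive y (1 : R) (fun z : R => q.[z^-1] * expR (- z^-1))
      (q.[y^-1] * (expR (- y^-1) * (y ^- 2)) +
       expR (- y^-1) * (q^`().[y^-1] * (- y ^- 2))).
    have Dq : is_derive y (1 : R) (fun z : R => q.[z^-1])
        (q^`().[y^-1] * (- y ^- 2)).
      exact: (@is_derive1_comp _ (horner q) (fun z : R => z^-1)).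
    apply: is_deriveM.
    apply: (@is_derive1_comp _ expR (fun z : R => - z^-1)).
    by rewrite -[y ^- 2]opprK; exact: is_deriveN.
  apply: is_derive_eq De _.
  rewrite /flat y0 hornerM hornerD hornerN hornerXn exprVn; ring.
- rewrite [X in is_derive _ _ _ X](_ : _ = 0); last first.
    by rewrite /flat ltNge (ltW y0).
  apply: (@near_eq_is_derive _ _ _ (cst 0)).
  near=> z; rewrite /flat ifF//; apply/negbTE; rewrite -leNgt ltW//.
  by near: z; exact: lt_nbhsl.
- rewrite [X in is_derive _ _ _ X](_ : _ = 0); last by rewrite /flat ltxx.
  have [K HK] := flat_bounded (q * 'X^2).
  apply: (@is_derive_sqr_bound _ _ K); first by rewrite /flat ltxx.
  move=> z; rewrite subr0 flat_sqr normrM ger0_norm ?sqr_ge0// mulrC.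
  by rewrite ler_wpM2r ?sqr_ge0.
Unshelve. all: by end_near. Qed.

Lemma ck_on_flat (D : set (R * R)) n q (f : R * R -> R) : open D -> ck_on D n f ->
  ck_on D n (fun z => flat q (f z)).
Proof.
move=> oD; apply: (@ck_on_comp _ (fun h => exists q, h = flat q)); last 2 first.
- by [].
- by exists q.
move=> _ [p ->]; exists (flat ((p - p^`()) * 'X^2)); first by eexists.
exact: is_derive_flat.
Qed.

End Flat.

(** * Polar coordinates *)

Section Polar.
Set Implicit Arguments.
Unset Strict Implicit.
Context {R : realType}.
Implicit Types (x : R * R) (k : 'I_2) (m : int) (b : bool).

Definition punctured : set (R * R) := ~` [set 0].

Lemma open_punctured : open punctured.
Proof.
exact/closed_openC/accessible_closed_set1/hausdorff_accessible/norm_hausdorff.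
Qed.

Definition coord k x : R := if k == 0 then x.1 else x.2.

Lemma ck_on_coord n k (D : set (R * R)) : open D -> ck_on D n (coord k).
Proof.
by move=> oD; have [H1 H2] := @ck_on_fst_snd R D n oD; rewrite /coord; case: (k == 0).
Qed.

Lemma is_derive_coord x k l :
  is_derive x (basis_vec l) (coord k) (k == l)%:R.
Proof.
have [D1 D2] := (is_derive_fst x (basis_vec l), is_derive_snd x (basis_vec l)).
by move: k l D1 D2 => [[|[|//]] ?] [[|[|//]] ?].
Qed.

Definition sqr_norm x : R := x.1 ^+ 2 + x.2 ^+ 2.

Lemma sqr_norm_gt0 x : x != 0 -> 0 < sqr_norm x.
Proof.
case: x => a b; rewrite -pair_eqE /= negb_and => /orP[] h.
  by rewrite ltr_pwDl// ?sqr_ge0// exprn_even_gt0.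
by rewrite ltr_wpDl// ?sqr_ge0// exprn_even_gt0.
Qed.

(** The coordinate [t = ln |x|], written so that no square root has to be differentiated. *)
Definition lnr x : R := ln (sqr_norm x) / 2.

Lemma expR_2lnr x : x != 0 -> expR (2 * lnr x) = sqr_norm x.
Proof.
by move=> x0; rewrite /lnr mulrC divfK// lnK// posrE sqr_norm_gt0.
Qed.

Lemma norm_R2E x : x != 0 -> norm_R2 x = expR (lnr x).
Proof.
move=> x0; rewrite /norm_R2 -/(sqr_norm x) -expR_2lnr// expRM_natl.
by rewrite sqrtr_sqr ger0_norm ?expR_ge0.
Qed.

Lemma is_derive_sqr_norm x k :
  is_derive x (basis_vec k) sqr_norm (2 * coord k x).
Proof.
have -> : sqr_norm = (coord 0) ^+ 2 + (coord 1) ^+ 2 by [].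
have D0 := is_derive_coord x 0 k; have D1 := is_derive_coord x 1 k.
apply: is_derive_eq; rewrite /GRing.scale /= /coord.
by case: k {D0 D1} => [[|[|//]] ?] /=; ring.
Qed.

Lemma is_derive_lnr x k : x != 0 ->
  is_derive x (basis_vec k) lnr (coord k x * expR (- 2 * lnr x)).
Proof.
move=> x0; have q0 := sqr_norm_gt0 x0.
have D1 := @is_derive_comp_dir _ (@ln R) _ _ _ _ _ (is_derive1_ln q0)
  (is_derive_sqr_norm x k).
have D2 : is_derive x (basis_vec k) (2^-1 \*: (fun y => ln (sqr_norm y)))
  (2^-1 *: ((sqr_norm x)^-1 * (2 * coord k x))) by exact: is_deriveZ.
have E : (2^-1 \*: (fun y => ln (sqr_norm y))) = lnr.
  by apply/funext => y; rewrite /lnr mulrC.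
rewrite E in D2; apply: is_derive_eq D2 _.
rewrite mulNr expRN expR_2lnr// /GRing.scale /=; field.
by rewrite gt_eqF.
Qed.

(** The partial derivatives [coord k x * expR (- 2 * lnr x)] are again built from [lnr], so order
    [n] yields order [n + 1]. *)
Lemma ck_on_lnr n : ck_on punctured n lnr.
Proof.
have c x : x != 0 -> {for x, continuous lnr}.
  move=> x0; apply: continuousM; last exact: cst_continuous.
  apply: (@continuous_comp _ _ _ sqr_norm (@ln R)).
    by apply: continuousD; apply: continuousM;
      by [exact: continuous_fstR|exact: continuous_sndR].
  exact/continuous_ln/sqr_norm_gt0.
elim: n => [|n IHn]; first by split=> [x /eqP/c|].
apply: (@ck_on_step _ _ _ _ (fun k x => coord k x * expR (- 2 * lnr x))).
- exact: open_punctured.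
- by move=> x /eqP/c.
- by move=> k x /eqP; exact: is_derive_lnr.
- move=> k; apply: ck_onM; [exact: open_punctured|..].
    exact/ck_on_coord/open_punctured.
  apply: ck_on_expR; first exact: open_punctured.
  by apply: ck_onZ; first exact: open_punctured.
Qed.

(** Real and imaginary parts of [(z / |z|)^n], which avoids choosing a branch of the angle. *)
Fixpoint trig n x : R * R :=
  if n is n'.+1 then
    let p := trig n' x in
    let c := x.1 * expR (- lnr x) in let s := x.2 * expR (- lnr x) in
    (p.1 * c - p.2 * s, p.1 * s + p.2 * c)
  else (1, 0).

(* [ang false m] and [ang true m] are [cos (m theta)] and [sin (m theta)], and
   [dang] is their derivative with respect to [m theta]. *)
Definition ang b m x : R :=
  if b then (sgz m)%:~R * (trig `|m| x).2 else (trig `|m| x).1.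

Definition dang b m x : R := if b then ang false m x else - ang true m x.

#[global] Arguments ang : simpl never.
#[global] Arguments dang : simpl never.

(** The partial derivatives of the angle, [(- x_2, x_1) / |x|^2], which are single-valued off the
    origin although the angle is not. *)
Definition dtheta k x : R :=
  (if k == 0 then - x.2 else x.1) * expR (- 2 * lnr x).

Lemma trig_sqr n x : x != 0 -> (trig n x).1 ^+ 2 + (trig n x).2 ^+ 2 = 1.
Proof.
move=> x0; elim: n => [|n IH] /=; first by rewrite expr1n expr0n addr0.
rewrite -[RHS]IH -[RHS]mulr1.
have : (x.1 ^+ 2 + x.2 ^+ 2) * expR (- lnr x) ^+ 2 = 1.
  rewrite -/(sqr_norm x) -expR_2lnr// -expRM_natl -expRD mulr_natl.
  by rewrite [X in expR X](_ : _ = 0) ?expR0//; ring.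
by move=> <-; ring.
Qed.

Lemma ang_sqr m x : x != 0 -> ang false m x ^+ 2 + ang true m x ^+ 2 = 1.
Proof.
move=> x0; rewrite /ang exprMn -[RHS](trig_sqr `|m| x0); congr (_ + _).
case: m => [[|n]|n] /=; rewrite ?sgz0 ?mulr0 ?expr0n ?mul0r//.
  by rewrite gtr0_sgz// expr1n mul1r.
by rewrite ltr0_sgz// sqrrN expr1n mul1r.
Qed.

Lemma ang_le1 b m x : x != 0 -> `|ang b m x| <= 1 /\ `|dang b m x| <= 1.
Proof.
move=> x0; have := ang_sqr m x0 => H.
have H1 : `|ang false m x| <= 1.
  by rewrite -(@expr_le1 _ 2)// real_normK ?num_real// -H lerDl sqr_ge0.
have H2 : `|ang true m x| <= 1.
  by rewrite -(@expr_le1 _ 2)// real_normK ?num_real// -H lerDr sqr_ge0.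
by rewrite /dang; case: b; rewrite ?normrN.
Qed.

Lemma is_derive_trig n x k : x != 0 ->
  is_derive x (basis_vec k) (fun y => (trig n y).1)
    (- n%:R * dtheta k x * (trig n x).2) /\
  is_derive x (basis_vec k) (fun y => (trig n y).2)
    (n%:R * dtheta k x * (trig n x).1).
Proof.
move=> x0.
have Dl := is_derive_lnr k x0.
have De : is_derive x (basis_vec k) (fun y => expR (- lnr y))
    (expR (- lnr x) * - (coord k x * expR (- 2 * lnr x))).
  exact: (is_derive_comp_dir (is_derive_expR _) (is_deriveN Dl)).
have D1 := is_derive_fst x (basis_vec k).
have D2 := is_derive_snd x (basis_vec k).
have E : x.1 ^+ 2 * expR (- 2 * lnr x) + x.2 ^+ 2 * expR (- 2 * lnr x) = 1.
  rewrite -mulrDl -/(sqr_norm x) -expR_2lnr// -expRD.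
  by rewrite [X in expR X](_ : _ = 0) ?expR0//; ring.
have Dc : is_derive x (basis_vec k) (fun y => y.1 * expR (- lnr y))
    (- dtheta k x * (x.2 * expR (- lnr x))).
  apply: is_derive_eq (is_deriveM D1 De) _.
  (* The last term is multiplied by [1 = |x|^2 / |x|^2], after which both sides agree as
     polynomials. *)
  rewrite /GRing.scale /= -[X in _ + X]mulr1 -[X in _ + _ * X]E.
  rewrite /coord /dtheta /basis_vec.
  by case: k {Dl De D1 D2} => [[|[|//]] ?] /=; ring.
have Ds : is_derive x (basis_vec k) (fun y => y.2 * expR (- lnr y))
    (dtheta k x * (x.1 * expR (- lnr x))).
  apply: is_derive_eq (is_deriveM D2 De) _.
  rewrite /GRing.scale /= -[X in _ + X]mulr1 -[X in _ + _ * X]E.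
  rewrite /coord /dtheta /basis_vec.
  by case: k {Dl De D1 D2 Dc} => [[|[|//]] ?] /=; ring.
elim: n => [|n [IH1 IH2]] /=.
  by rewrite oppr0 !mul0r; split; exact: is_derive_cst.
split.
  apply: is_derive_eq (is_deriveB (is_deriveM IH1 Dc) (is_deriveM IH2 Ds)) _.
  by rewrite /GRing.scale /= -natr1; ring.
apply: is_derive_eq (is_deriveD (is_deriveM IH1 Ds) (is_deriveM IH2 Dc)) _.
by rewrite /GRing.scale /= -natr1; ring.
Qed.

Lemma is_derive_ang b m x k : x != 0 ->
  is_derive x (basis_vec k) (ang b m) (m%:~R * dtheta k x * dang b m x).
Proof.
move=> x0; have [D1 D2] := is_derive_trig `|m| k x0.
have Em : (m%:~R : R) = (sgz m)%:~R * (`|m|%N)%:R.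
  by rewrite [in LHS](intEsg m) intrM.
have Es : m != 0 -> ((sgz m)%:~R * (sgz m)%:~R : R) = 1.
  by case: (ltrgt0P m) => // h _; rewrite ?(gtr0_sgz h) ?(ltr0_sgz h) -intrM.
(* The cosine needs [sgz m] to square to [1], which fails at [m = 0]; there [ang] is constant. *)
have [->|m0] := eqVneq m 0.
  rewrite !mul0r /ang sgz0 absz0; case: b; last exact: is_derive_cst.
  under eq_fun do rewrite mul0r.
  exact: is_derive_cst.
rewrite /dang /ang; case: b.
  apply: is_derive_eq (is_deriveZ (sgz m)%:~R D2) _.
  by rewrite Em /GRing.scale /ang /= !mulrA.
apply: is_derive_eq D1 _.
rewrite Em -[LHS]mulr1 -[X in _ * X = _](Es m0) /ang /=.
by move: ((sgz m)%:~R : R) ((`|m|%N)%:R : R) => a b; ring.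
Qed.

Lemma ck_on_ang n b m : ck_on punctured n (ang b m).
Proof.
have o := open_punctured.
have [c1 c2] := @ck_on_fst_snd R _ n o.
have ce : ck_on punctured n (fun x : R * R => expR (- lnr x)).
  apply: ck_on_expR => //.
  have := ck_onZ (-1) o (ck_on_lnr n).
  by under eq_fun do rewrite mulN1r.
have [ct1 ct2] : ck_on punctured n (fun x => (trig `|m| x).1) /\
    ck_on punctured n (fun x => (trig `|m| x).2).
  elim: `|m|%N => [|j [IH1 IH2]] /=; first by split; exact: ck_on_cst.
  split; last first.
    by apply: ck_onD => //; apply: ck_onM => //; exact: ck_onM.
  have H := ck_onZ (-1) o (ck_onM o IH2 (ck_onM o c2 ce)).
  have := ck_onD o (ck_onM o IH1 (ck_onM o c1 ce)) H.
  by under eq_fun do rewrite mulN1r.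
by rewrite /ang; case: b => //; exact: ck_onZ.
Qed.

End Polar.

(** * Components of the solution *)

Section Wave.
Set Implicit Arguments.
Unset Strict Implicit.
Context {R : realType} (lam a : R).
Implicit Types (x : R * R) (k : 'I_2) (m : int) (b p : bool) (s : R).

Definition slope x : R := - lam * lnr x.

Definition gauss x : R := expR (- lam * lnr x ^+ 2 / 2).

(** The [chi] of the construction: [e^(- 1 / (a^2 - s^2))] where [s^2 < a^2], and [0] elsewhere. *)
Definition bump s : R := flat 1 (a ^+ 2 - s ^+ 2).

Definition dbump s : R := flat 'X^2 (a ^+ 2 - s ^+ 2) * (- 2 * s).

Definition amp m x : R := gauss x * bump (slope x - m%:~R).

(** The derivative of [A_m] in [t = ln |x|], from [rho' = s] and [s' = - lam]. *)
Definition damp m x : R := gauss x *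
  (slope x * bump (slope x - m%:~R) - lam * dbump (slope x - m%:~R)).

(* An integer of the parity of [p] nearest to [s]. *)
Definition mode p s : int := 2 * Num.floor ((s + 1 - p%:R) / 2) + p%:Z.

(* The value at [0] has to be prescribed: [lnr 0 = 0], as [ln 0 = 0]. *)
Definition wave p b x : R := if x == 0 then 0 else
  let m := mode p (slope x) in amp m x * ang b m x.

(** The product rule with the mode frozen, which [near_wave_eq] justifies off the origin. The value
    at [0] is the true derivative there, by flatness. *)
Definition dwave p b k x : R := if x == 0 then 0 else
  let m := mode p (slope x) in
  damp m x * (coord k x * expR (- 2 * lnr x)) * ang b m x +
  amp m x * (m%:~R * dtheta k x * dang b m x).

Lemma mode_itv p s : -1 <= s - (mode p s)%:~R < 1.
Proof.
rewrite /mode rmorphD rmorphM /=.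
have := floor_le ((s + 1 - p%:R) / 2); have := floorD1_gt ((s + 1 - p%:R) / 2).
rewrite rmorphD /= -[p%:~R]/(p%:R); move: (Num.floor _)%:~R => j; lra.
Qed.

Lemma mode_le1 p s : `|s - (mode p s)%:~R| <= 1.
Proof. have := mode_itv p s => /andP[? ?]; rewrite ler_norml; lra. Qed.

Lemma mode_far p s s' : mode p s != mode p s' ->
  2 <= `|(mode p s)%:~R - (mode p s')%:~R : R|.
Proof.
move=> ne; rewrite -rmorphB -intr_norm -[2]/(2%:Z%:~R) ler_int.
move: ne; rewrite /mode; move: (Num.floor _) (Num.floor _) => i j.
lia.
Qed.

(** The selected even and odd integers are consecutive and enclose [s], so one of them is within
    [1/2]. Hence at every point some mode has a bump bounded below. *)
Lemma mode_near_half s :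
  exists p, `|s - (mode p s)%:~R| <= 1 / 2.
Proof.
have [h|h] := leP `|s - (mode false s)%:~R| (1 / 2); first by exists false.
exists true.
have : (mode true s)%:~R - (mode false s)%:~R = 1 :> R \/
    (mode true s)%:~R - (mode false s)%:~R = -1 :> R.
  have /andP[h1 h2] := mode_itv true s; have /andP[h3 h4] := mode_itv false s.
  (* The difference is odd and lies strictly between [-2] and [2]. *)
  have H1 : (- 2 : int) < mode true s - mode false s.
    by rewrite -(ltr_int R) rmorphB rmorphN rmorph_nat /=; lra.
  have H2 : mode true s - mode false s < (2 : int).
    by rewrite -(ltr_int R) rmorphB rmorph_nat /=; lra.
  have : mode true s - mode false s = 1 \/ mode true s - mode false s = - 1.
    by move: H1 H2; rewrite /mode; move: (Num.floor _) (Num.floor _) => i j; lia.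
  by rewrite -rmorphB; case=> ->; [left|right].
have := mode_itv true s; have := mode_itv false s.
move: h; rewrite lter_normr ler_norml.
move: ((mode true s)%:~R : R) ((mode false s)%:~R : R) => i j.
by move=> /orP[] ? /andP[? ?] /andP[? ?] [] ?; lra.
Qed.

Lemma flat_le0 (q : {poly R}) s : s <= 0 -> flat q s = 0.
Proof. by move=> s0; rewrite /flat ltNge s0. Qed.

Lemma bump_eq0 s : 0 <= a -> a <= `|s| -> bump s = 0 /\ dbump s = 0.
Proof.
move=> a0 as_; have h : a ^+ 2 - s ^+ 2 <= 0.
  by rewrite subr_le0 -(real_normK (num_real s)) lerXn2r// nnegrE.
by rewrite /bump /dbump !flat_le0// mul0r.
Qed.

Lemma bump_ge0_le1 s : 0 <= bump s <= 1.
Proof.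
rewrite /bump /flat; case: ifPn => [h|_]; last by rewrite lexx ler01.
rewrite hornerC mul1r expR_ge0 -expR0 ler_expR oppr_le0 invr_ge0 ltW//.
Qed.

(** With [v = (a^2 - s^2)^-1], the first factor is [v^2 e^(-v) <= 2! = 2], and the second is at most
    [2]. The bound does not depend on [a]. *)
Lemma dbump_le4 s : `|s| <= 1 -> `|dbump s| <= 4.
Proof.
move=> s1; rewrite /dbump /flat; case: ifPn => [h|_]; last first.
  by rewrite mul0r normr0.
rewrite hornerXn normrM [`|- 2 * s|]normrM normrN.
have i0 : 0 <= (a ^+ 2 - s ^+ 2)^-1 by rewrite invr_ge0 ltW.
have := exprn_expRN_le 2 i0.
rewrite ger0_norm ?mulr_ge0 ?exprn_ge0 ?expR_ge0// => H.
rewrite (ger0_norm (ler0n _ 2)).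
apply: (@le_trans _ _ (2 * (2 * 1))); last by rewrite mulr1 -natrM.
by rewrite ler_pM ?mulr_ge0 ?exprn_ge0 ?expR_ge0// ler_pM2l.
Qed.

(** Here [a > 1/2] enters: [bump] is positive on [[-1/2, 1/2]], and [e] is its value at the
    endpoints, where it is smallest. *)
Lemma bump_half : 1 / 2 < a -> exists2 e, 0 < e &
  forall s, `|s| <= 1 / 2 -> e <= bump s.
Proof.
move=> a12; have h0 : 0 < a ^+ 2 - 1 / 4 by nra.
exists (expR (- (a ^+ 2 - 1 / 4)^-1)); first exact: expR_gt0.
move=> s hs; have h : a ^+ 2 - 1 / 4 <= a ^+ 2 - s ^+ 2.
  by move: hs; rewrite ler_norml => /andP[? ?]; nra.
rewrite /bump /flat (lt_le_trans h0 h) hornerC (mul1r (expR _)) ler_expR lerN2.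
by rewrite lef_pV2// posrE ?(lt_le_trans h0 h).
Qed.

(* Distinct modes of the same parity are at least [2] apart, so where the two
   sides use different modes both bumps vanish. *)
Lemma wave_eq p b x s : 0 <= a < 1 -> x != 0 ->
  `|slope x - (mode p s)%:~R| < 2 - a ->
  wave p b x = amp (mode p s) x * ang b (mode p s) x.
Proof.
move=> /andP[a0 a1] x0 near_m; rewrite /wave (negbTE x0).
have [->//|/mode_far far] := eqVneq (mode p (slope x)) (mode p s).
have v1 := mode_le1 p (slope x).
have tri := ler_distD (slope x) (mode p (slope x))%:~R (mode p s)%:~R.
rewrite [X in _ <= X + _]distrC in tri.
have hv : a <= `|slope x - (mode p (slope x))%:~R| by lra.
have hu : a <= `|slope x - (mode p s)%:~R| by lra.
by rewrite /amp (bump_eq0 a0 hv).1 (bump_eq0 a0 hu).1 !mulr0 !mul0r.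
Qed.

Lemma is_derive_bump s : is_derive s (1 : R) bump (dbump s).
Proof.
have D : is_derive s (1 : R) (fun s : R => a ^+ 2 - s ^+ 2) (- 2 * s).
  by apply: is_derive_eq; rewrite /GRing.scale /=; ring.
apply: is_derive_eq (@is_derive1_comp _ (flat 1) (fun s : R => a ^+ 2 - s ^+ 2)
  _ _ _ (is_derive_flat 1 _) D) _.
by rewrite derivC subr0 mul1r.
Qed.

Lemma is_derive_slope x k : x != 0 -> is_derive x (basis_vec k) slope
  (- lam * (coord k x * expR (- 2 * lnr x))).
Proof. by move=> x0; exact: is_deriveZ (is_derive_lnr k x0). Qed.

Lemma is_derive_gauss x k : x != 0 -> is_derive x (basis_vec k) gauss
  (gauss x * (slope x * (coord k x * expR (- 2 * lnr x)))).
Proof.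
move=> x0; have Dl := is_derive_lnr k x0.
have D : is_derive x (basis_vec k) (fun y => - lam * lnr y ^+ 2 / 2)
    (slope x * (coord k x * expR (- 2 * lnr x))).
  have Dh : is_derive (lnr x) (1 : R) (fun t => - lam * t ^+ 2 / 2) (- lam * lnr x).
    by apply: is_derive_eq; rewrite /GRing.scale /=; field.
  exact: (is_derive_comp_dir Dh Dl).
exact: (is_derive_comp_dir (is_derive_expR _) D).
Qed.

Lemma is_derive_amp x m k : x != 0 -> is_derive x (basis_vec k) (amp m)
  (damp m x * (coord k x * expR (- 2 * lnr x))).
Proof.
move=> x0.
have Ds : is_derive x (basis_vec k) (fun y => slope y - m%:~R)
    (- lam * (coord k x * expR (- 2 * lnr x)) - 0).
  exact: is_deriveB (is_derive_slope k x0) (is_derive_cst _ _ _).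
have Db := is_derive_comp_dir (is_derive_bump _) Ds.
apply: is_derive_eq (is_deriveM (is_derive_gauss k x0) Db) _.
by rewrite /GRing.scale /damp /=; ring.
Qed.

Lemma ck_on_amp n m : ck_on punctured n (amp m).
Proof.
have o := @open_punctured R.
have cs : ck_on punctured n slope by exact: ck_onZ (ck_on_lnr n).
apply: ck_onM => //.
  apply: ck_on_expR => //.
  have cl2 := ck_onM o (ck_on_lnr n) (ck_on_lnr n).
  exact: ck_onM o (ck_onZ (- lam) o cl2) (ck_on_cst n 2^-1 o).
apply: ck_on_flat => //.
have cd := ck_onD o cs (ck_on_cst n (- m%:~R) o).
have := ck_onD o (ck_on_cst n (a ^+ 2) o) (ck_onZ (-1) o (ck_onM o cd cd)).
by apply: ck_on_eq => // y _; rewrite /= mulN1r.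
Qed.

(** The distance from [slope x] to its mode is at most [1 < 2 - a], so by continuity the hypothesis
    of [wave_eq] persists near [x]. The mode may thus be frozen even where [mode] jumps. *)
Lemma near_wave_eq p b x : 0 <= a < 1 -> x != 0 -> \forall y \near x,
  wave p b y = amp (mode p (slope x)) y * ang b (mode p (slope x)) y.
Proof.
move=> a01 x0; set m := mode p (slope x).
have cs : {for x, continuous (fun y => slope y - m%:~R)}.
  apply: continuousB; last exact: cst_continuous.
  apply: continuousM; first exact: cst_continuous.
  exact: (ck_on_continuous (ck_on_lnr 0) (elimN eqP x0)).
have lt_m : `|slope x - m%:~R| < 2 - a.
  by have := mode_le1 p (slope x); rewrite -/m; lra.
have near0 : \near x, x != 0.
  have := open_nbhs_nbhs (conj (@open_punctured R) (elimN eqP x0)).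
  by apply: filterS => y /eqP.
have near_m : \forall y \near x, `|slope y - m%:~R| < 2 - a.
  exact: (cvgr_norm_lt _ cs _ lt_m).
by near=> y; apply: wave_eq => //; near: y.
Unshelve. all: by end_near. Qed.

Lemma is_derive_wave p b x k : 0 <= a < 1 -> x != 0 ->
  is_derive x (basis_vec k) (wave p b) (dwave p b k x).
Proof.
move=> a01 x0; apply: near_eq_is_derive.
  have := near_wave_eq p b a01 x0; apply: filterS => y ->.
  by rewrite (_ : _ * _ = (amp (mode p (slope x)) * ang b (mode p (slope x))) y).
apply: is_derive_eq (is_deriveM (is_derive_amp _ k x0) (is_derive_ang b _ k x0)) _.
by rewrite /dwave (negbTE x0) /GRing.scale /=; ring.
Qed.

Lemma ck_on_wave n p b : 0 <= a < 1 -> ck_on punctured n (wave p b).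
Proof.
move=> a01; apply: ck_on_local => x /eqP x0.
exists (fun y => amp (mode p (slope x)) y * ang b (mode p (slope x)) y).
  by apply: ck_onM; [exact: open_punctured|exact: ck_on_amp|exact: ck_on_ang].
exact: near_wave_eq.
Qed.

Lemma coord_le x k : x != 0 -> `|coord k x| <= expR (lnr x).
Proof.
move=> x0; rewrite -norm_R2E// /norm_R2 -sqrtr_sqr ler_sqrt ?addr_ge0 ?sqr_ge0//.
by rewrite /coord; case: ifP => _; rewrite ?lerDl ?lerDr sqr_ge0.
Qed.

Lemma dtheta_le x k : x != 0 -> `|dtheta k x| <= expR (- lnr x).
Proof.
move=> x0; have e0 := expR_ge0 (- 2 * lnr x).
rewrite /dtheta normrM (ger0_norm e0).
rewrite (_ : expR (- lnr x) = expR (lnr x) * expR (- 2 * lnr x)); last first.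
  by rewrite -expRD; congr expR; ring.
rewrite ler_wpM2r//; case: ifP => _; rewrite ?normrN.
  exact: (coord_le 1).
exact: (coord_le 0).
Qed.

Lemma gauss_gt0 x : 0 < gauss x. Proof. exact: expR_gt0. Qed.

Lemma wave_le p b x : x != 0 -> `|wave p b x| <= gauss x.
Proof.
move=> x0; rewrite /wave (negbTE x0) /amp normrM normrM.
have [h _] := ang_le1 b (mode p (slope x)) x0.
rewrite (ger0_norm (ltW (gauss_gt0 x))) -mulrA.
apply: ler_piMr; first exact/ltW/gauss_gt0.
have /andP[h0 h1] := bump_ge0_le1 (slope x - (mode p (slope x))%:~R).
by rewrite mulr_ile1// ger0_norm.
Qed.

(** The radial part contributes [|t| + 4] and the angular part [|t| + 1], because the mode is within
    [1] of [slope x] and [lam <= 1]. The partial derivatives of [t] and of the angle are at most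
    [1 / |x|]. *)
Lemma dwave_le p b x k : 0 <= lam <= 1 -> x != 0 ->
  `|dwave p b k x| <= gauss x * (2 * `|lnr x| + 5) * expR (- lnr x).
Proof.
move=> /andP[l0 l1] x0; rewrite /dwave (negbTE x0).
set m := mode p _; have m1 := mode_le1 p (slope x); rewrite -/m in m1.
have [h1 h2] := ang_le1 b m x0.
have g0 := gauss_gt0 x.
have /andP[b0 b1] := bump_ge0_le1 (slope x - m%:~R).
have d4 := dbump_le4 m1.
have sl : `|slope x| <= `|lnr x|.
  by rewrite normrM normrN (ger0_norm l0) ler_piMl.
have mle : `|m%:~R : R| <= `|lnr x| + 1.
  have := ler_distD (slope x) (m%:~R) 0; rewrite !subr0 distrC; lra.
have dampE : `|damp m x| <= gauss x * (`|lnr x| + 4).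
  rewrite /damp normrM (ger0_norm (ltW g0)) ler_pM2l//.
  apply: le_trans (ler_normB _ _) _; apply: lerD.
    rewrite normrM (ger0_norm b0); apply: le_trans sl.
    by rewrite ler_piMr.
  by rewrite normrM (ger0_norm l0); apply: le_trans d4; rewrite ler_piMl.
have ampE : `|amp m x| <= gauss x.
  by rewrite /amp normrM (ger0_norm (ltW g0)) (ger0_norm b0) ler_piMr// ltW.
have ce : `|coord k x * expR (- 2 * lnr x)| <= expR (- lnr x).
  rewrite normrM (ger0_norm (expR_ge0 _)).
  rewrite (_ : expR (- lnr x) = expR (lnr x) * expR (- 2 * lnr x)); last first.
    by rewrite -expRD; congr expR; ring.
  by rewrite ler_wpM2r ?expR_ge0 ?coord_le.
have -> : gauss x * (2 * `|lnr x| + 5) * expR (- lnr x) =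
  gauss x * (`|lnr x| + 4) * expR (- lnr x) * 1 +
  gauss x * ((`|lnr x| + 1) * expR (- lnr x) * 1) by ring.
apply: le_trans (ler_normD _ _) _; apply: lerD.
  by rewrite normrM ler_pM// normrM ler_pM.
rewrite normrM ler_pM// normrM ler_pM// normrM ler_pM//.
exact: dtheta_le.
Qed.

(** A Gaussian in [t] beats every exponential of [t]. As [expR (B * lnr x)] is [|x|^B] off the
    origin, with [B] of either sign, this is decay faster than any power at the origin and at
    infinity. *)
Lemma gauss_decay (B : R) : 0 < lam ->
  exists2 K, 0 <= K & forall x, gauss x * (2 * `|lnr x| + 5) <= K * expR (B * lnr x).
Proof.
(* The linear factor is at most [5 e^|t|], which raises [|B|] to [|B| + 1]; the exponent is what
   remains after completing the square. *)
move=> l0; exists (5 * expR ((`|B| + 1) ^+ 2 / (2 * lam))).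
  by rewrite mulr_ge0 ?expR_ge0.
move=> x; set t := lnr x.
have h1 : 2 * `|t| + 5 <= 5 * expR `|t|.
  by have := expR_ge1Dx `|t|; have := normr_ge0 t; lra.
have h2 : gauss x * expR `|t| <= expR ((`|B| + 1) ^+ 2 / (2 * lam)) * expR (B * t).
  (* [- lam t^2 / 2 + (|B| + 1) |t| <= (|B| + 1)^2 / (2 lam)] *)
  rewrite /gauss -/t -!expRD ler_expR.
  have e1 : - (`|B| * `|t|) <= B * t by rewrite lerNl -normrM -normrN ler_norm.
  have e2 : t ^+ 2 = `|t| ^+ 2 by rewrite real_normK// num_real.
  rewrite e2.
  apply: (@le_trans _ _ ((`|B| + 1) ^+ 2 / (2 * lam) + - (`|B| * `|t|)));
    last by rewrite lerD2l.
  rewrite -subr_ge0.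
  have -> : (`|B| + 1) ^+ 2 / (2 * lam) + - (`|B| * `|t|) -
      (- lam * `|t| ^+ 2 / 2 + `|t|) = (`|B| + 1 - lam * `|t|) ^+ 2 / (2 * lam).
    by field; rewrite gt_eqF.
  by rewrite mulr_ge0 ?sqr_ge0// invr_ge0 mulr_ge0// ltW.
have g0 := gauss_gt0 x.
apply: (@le_trans _ _ (gauss x * (5 * expR `|t|))); first by rewrite ler_pM2l.
by rewrite mulrCA -mulrA ler_pM2l.
Qed.

End Wave.

(** * The Dirac operator on the solution *)

Section Spinor.
Set Implicit Arguments.
Unset Strict Implicit.
Context {R : realType} (lam a : R).
Implicit Types (x : R * R) (u : R * R -> 'cV[R[i]]_2).
Local Open Scope complex_scope.

Lemma norm_C2_sqr (z : 'cV[R[i]]_2) : norm_C2 z ^+ 2 =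
  (complex.Re (z 0 0)) ^+ 2 + (complex.Im (z 0 0)) ^+ 2 +
  ((complex.Re (z 1 0)) ^+ 2 + (complex.Im (z 1 0)) ^+ 2).
Proof.
rewrite /norm_C2 sqr_sqrtr; last first.
  by apply: sumr_ge0 => i _; rewrite addr_ge0 ?sqr_ge0.
by rewrite big_ord_recl big_ord1 (_ : lift ord0 ord0 = 1)//; exact/val_inj.
Qed.

Lemma norm_C2_ge0 (z : 'cV[R[i]]_2) : 0 <= norm_C2 z.
Proof. exact: sqrtr_ge0. Qed.

Lemma ord2_lift0 : lift ord0 ord0 = 1 :> 'I_2.
Proof. exact/val_inj. Qed.

Lemma sigma1_mul (v : 'cV[R[i]]_2) :
  ((sigma1 *m v) 0 0 = v 1 0) * ((sigma1 *m v) 1 0 = v 0 0).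
Proof.
by split; rewrite mxE big_ord_recl big_ord1 !mxE ord2_lift0 mul0r mul1r;
  rewrite ?add0r ?addr0.
Qed.

Lemma sigma2_mul (v : 'cV[R[i]]_2) :
  ((sigma2 *m v) 0 0 = - 'i * v 1 0) * ((sigma2 *m v) 1 0 = 'i * v 0 0).
Proof.
by split; rewrite mxE big_ord_recl big_ord1 !mxE ord2_lift0 mul0r ?add0r ?addr0.
Qed.

Lemma dirac2E u x j : dirac2 u x j 0 =
  - ('i * (sigma1 *m partial_C2 0 u x) j 0) - 'i * (sigma2 *m partial_C2 1 u x) j 0.
Proof.
rewrite /dirac2; move: (sigma1 *m _) (sigma2 *m _) => v w.
by rewrite !mxE.
Qed.

(** The first line of the sum is [|2 d/dz u_2|^2] and the second [|2 d/dzbar u_1|^2]: the two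
    components decouple. *)
Lemma dirac2_norm u x :
  let a k j := 'D_(basis_vec k) (fun y => complex.Re (u y j 0)) x in
  let b k j := 'D_(basis_vec k) (fun y => complex.Im (u y j 0)) x in
  norm_C2 (dirac2 u x) ^+ 2 =
    (b 0 1 - a 1 1) ^+ 2 + (a 0 1 + b 1 1) ^+ 2 +
    ((b 0 0 + a 1 0) ^+ 2 + (b 1 0 - a 0 0) ^+ 2).
Proof.
move=> a' b'.
have pE k j : partial_C2 k u x j 0 = a' k j +i* b' k j by rewrite mxE.
clearbody a' b'; rewrite norm_C2_sqr.
have -> : dirac2 u x 0 0 =
    - ('i * (a' 0 1 +i* b' 0 1)) - 'i * (- 'i * (a' 1 1 +i* b' 1 1)).
  rewrite dirac2E -2!pE; congr (- (_ * _) - _ * _).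
    exact: (sigma1_mul _).1.
  exact: (sigma2_mul _).1.
have -> : dirac2 u x 1 0 =
    - ('i * (a' 0 0 +i* b' 0 0)) - 'i * ('i * (a' 1 0 +i* b' 1 0)).
  rewrite dirac2E -2!pE; congr (- (_ * _) - _ * _).
    exact: (sigma1_mul _).2.
  exact: (sigma2_mul _).2.
move: (a' 0 1) (a' 1 1) (b' 0 1) (b' 1 1) (a' 0 0) (a' 1 0) (b' 0 0) (b' 1 0).
by move=> p q r s p' q' r' s' /=; ring.
Qed.

(** The odd wave enters conjugated. Conjugation exchanges [d/dz] and [d/dzbar], so both components
    fall under [wave_cauchy_riemann]. *)
Definition spinor x : 'cV[R[i]]_2 :=
  \col_j (if j == 0 then wave lam a false false x +i* wave lam a false true x
          else wave lam a true false x +i* - wave lam a true true x).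

Lemma spinor_components x : (complex.Re (spinor x 0 0) = wave lam a false false x) *
  (complex.Im (spinor x 0 0) = wave lam a false true x) *
  (complex.Re (spinor x 1 0) = wave lam a true false x) *
  (complex.Im (spinor x 1 0) = - wave lam a true true x).
Proof. by rewrite !mxE. Qed.

Lemma wave_sqr p x : x != 0 -> wave lam a p false x ^+ 2 + wave lam a p true x ^+ 2 =
  amp lam a (mode p (slope lam x)) x ^+ 2.
Proof.
move=> x0; rewrite /wave (negbTE x0) /=; have := ang_sqr (mode p (slope lam x)) x0.
move: (ang false _ x) (ang true _ x) (amp _ _ _ x) => c s A H.
by rewrite !exprMn -mulrDr H mulr1.
Qed.

Lemma norm_spinor x : x != 0 -> norm_C2 (spinor x) ^+ 2 =
  amp lam a (mode false (slope lam x)) x ^+ 2 +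
  amp lam a (mode true (slope lam x)) x ^+ 2.
Proof.
by move=> x0; rewrite norm_C2_sqr !spinor_components sqrrN !wave_sqr.
Qed.

(* Both sides are [|2 d/dzbar (A e^(i m theta))|^2]. *)
Lemma wave_cauchy_riemann p x : x != 0 ->
  let D k b := dwave lam a p b k x in
  let m := mode p (slope lam x) in
  (D 0 false - D 1 true) ^+ 2 + (D 0 true + D 1 false) ^+ 2 =
  (damp lam a m x - m%:~R * amp lam a m x) ^+ 2 * expR (- 2 * lnr x).
Proof.
move=> x0 D m; have H := ang_sqr m x0.
have E : (x.1 ^+ 2 + x.2 ^+ 2) * expR (- 2 * lnr x) = 1.
  rewrite -/(sqr_norm x) -expR_2lnr// -expRD.
  by rewrite [X in expR X](_ : _ = 0) ?expR0//; ring.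
rewrite /D /dwave (negbTE x0) -/m.
rewrite /coord /dtheta /dang /=.
move: (ang false m x) (ang true m x) (damp _ _ _ _) (amp _ _ _ _) H E => c s B A H E.
move: (x.1) (x.2) (expR _) (m%:~R) E => p1 p2 e n E.
(* The right-hand side is multiplied by the left-hand sides of [H] and [E], both equal to [1], to
   obtain a polynomial identity. *)
rewrite -[RHS]mulr1 -[X in _ = _ * X]mulr1 -[X in _ = _ * (X * _)]H.
by rewrite -[X in _ = _ * (_ * X)]E; ring.
Qed.

Lemma dirac_spinor x : 0 <= a < 1 -> x != 0 -> norm_C2 (dirac2 spinor x) ^+ 2 =
  ((damp lam a (mode false (slope lam x)) x -
      (mode false (slope lam x))%:~R * amp lam a (mode false (slope lam x)) x) ^+ 2 +
   (damp lam a (mode true (slope lam x)) x -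
      (mode true (slope lam x))%:~R * amp lam a (mode true (slope lam x)) x) ^+ 2) *
  expR (- 2 * lnr x).
Proof.
move=> a01 x0; rewrite dirac2_norm.
have Dw p b k := @derive_val _ _ _ _ _ _ _ (is_derive_wave lam p b k a01 x0).
have R0 : (fun y => complex.Re (spinor y 0 0)) = wave lam a false false.
  by apply/funext => y; rewrite spinor_components.
have I0 : (fun y => complex.Im (spinor y 0 0)) = wave lam a false true.
  by apply/funext => y; rewrite spinor_components.
have R1 : (fun y => complex.Re (spinor y 1 0)) = wave lam a true false.
  by apply/funext => y; rewrite spinor_components.
have I1 : (fun y => complex.Im (spinor y 1 0)) = - wave lam a true true.
  by apply/funext => y; rewrite spinor_components.
have Dd p b k := @ex_derive _ _ _ _ _ _ _ (is_derive_wave lam p b k a01 x0).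
rewrite R0 I0 R1 I1 !(deriveN (Dd _ _ _)).
rewrite !Dw mulrDl -!wave_cauchy_riemann//.
by move: (dwave _ _) => d; ring.
Qed.

End Spinor.

(** * The differential inequality and nontriviality *)

Section DiracBound.
Set Implicit Arguments.
Unset Strict Implicit.
Context {R : realType}.

(** Expanding each square, the main term is at most [a^2 B^2], the cross term [8 lam] and the last
    [16 lam^2 <= 16 lam]. Two modes lose [48 lam] in all, absorbed by [(C^2 - a^2) (B^2 + B'^2) >=
    (C^2 - a^2) e^2]. *)
Lemma bump_ineq (lam a C s t e B B' E E' : R) : 0 <= lam <= 1 -> 0 <= a ->
  `|s| <= 1 -> `|t| <= 1 ->
  0 <= B <= 1 -> 0 <= B' <= 1 -> `|E| <= 4 -> `|E'| <= 4 ->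
  `|s * B| <= a * B -> `|t * B'| <= a * B' ->
  e <= B \/ e <= B' -> 0 <= e -> a <= C -> 48 * lam <= (C ^+ 2 - a ^+ 2) * e ^+ 2 ->
  (s * B - lam * E) ^+ 2 + (t * B' - lam * E') ^+ 2 <= C ^+ 2 * (B ^+ 2 + B' ^+ 2).
Proof.
move=> /andP[l0 l1] a0 s1 t1 /andP[B0 B1] /andP[B0' B1'] E4 E4' sB tB eB e0 aC lamE.
have one (r b d : R) : 0 <= b <= 1 -> `|r| <= 1 -> `|d| <= 4 -> `|r * b| <= a * b ->
    (r * b - lam * d) ^+ 2 <= a ^+ 2 * b ^+ 2 + 24 * lam.
  move=> /andP[b0 b1] r1 d4 rb.
  have h1 : (r * b) ^+ 2 <= a ^+ 2 * b ^+ 2.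
    by rewrite -(real_normK (num_real (r * b))) -exprMn lerXn2r// nnegrE mulr_ge0.
  have rb1 : `|r * b| <= 1 by rewrite normrM mulr_ile1// ger0_norm.
  have h2 : - ((r * b) * d) <= 4.
    apply: le_trans (ler_norm _) _; rewrite normrN normrM -[4]mul1r.
    exact: ler_pM.
  have h3 : d ^+ 2 <= 16.
    rewrite -(real_normK (num_real d)) (_ : 16 = 4 ^+ 2 :> R); last by ring.
    by rewrite lerXn2r// nnegrE.
  have h4 : lam * (- ((r * b) * d)) <= lam * 4 by rewrite ler_wpM2l.
  have h5 : lam ^+ 2 * d ^+ 2 <= lam * 16.
    by rewrite ler_pM ?sqr_ge0// expr2 ler_piMr.
  have -> : (r * b - lam * d) ^+ 2 = (r * b) ^+ 2 + 2 * (lam * (- ((r * b) * d))) +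
    lam ^+ 2 * d ^+ 2 by ring.
  lra.
have H1 : (s * B - lam * E) ^+ 2 <= a ^+ 2 * B ^+ 2 + 24 * lam.
  by apply: one => //; rewrite B0.
have H2 : (t * B' - lam * E') ^+ 2 <= a ^+ 2 * B' ^+ 2 + 24 * lam.
  by apply: one => //; rewrite B0'.
have H3 : e ^+ 2 <= B ^+ 2 + B' ^+ 2.
  have := sqr_ge0 B; have := sqr_ge0 B'; case: eB => h.
    have : e ^+ 2 <= B ^+ 2 by rewrite lerXn2r.
    lra.
  have : e ^+ 2 <= B' ^+ 2 by rewrite lerXn2r.
  lra.
have H4 : 0 <= C ^+ 2 - a ^+ 2.
  by rewrite subr_ge0 lerXn2r// nnegrE (le_trans a0).
have H5 := ler_wpM2l H4 H3.
lra.
Qed.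

Lemma bump_mul_le (a s : R) : 0 <= a -> `|s * bump a s| <= a * bump a s.
Proof.
move=> a0; have /andP[b0 _] := bump_ge0_le1 a s.
rewrite normrM (ger0_norm b0); have [h|h] := leP a `|s|.
  by rewrite (bump_eq0 a0 h).1 !mulr0.
by rewrite ler_wpM2r// ltW.
Qed.

Lemma spinor_dirac_le (C a e lam : R) : 0 <= lam <= 1 -> 0 <= a < 1 -> 0 <= e ->
  (forall s, `|s| <= 1 / 2 -> e <= bump a s) -> a <= C ->
  48 * lam <= (C ^+ 2 - a ^+ 2) * e ^+ 2 ->
  forall x : R * R, x != 0 ->
    norm_C2 (dirac2 (spinor lam a) x) <= C / norm_R2 x * norm_C2 (spinor lam a x).
Proof.
move=> lam01 a01 e0 he aC lamE x x0; have /andP[a0 a1] := a01.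
have C0 : 0 <= C by exact: le_trans aC.
have CR0 : 0 <= C / norm_R2 x by rewrite divr_ge0// sqrtr_ge0.
rewrite -(@ler_pXn2r _ 2)// ?nnegrE ?mulr_ge0 ?norm_C2_ge0 ?invr_ge0 ?sqrtr_ge0//.
rewrite exprMn norm_spinor// dirac_spinor// norm_R2E//.
rewrite exprMn -expRN.
rewrite (_ : expR (- lnr x) ^+ 2 = expR (- 2 * lnr x)); last first.
  by rewrite expr2 -expRD; congr expR; ring.
rewrite [leRHS]mulrAC ler_wpM2r ?expR_ge0//.
set m := mode false _; set n := mode true _.
(* In [A' - m A] the growth rate appears only through its distance to the mode, which is below [a]
   on the support of the bump. *)
have Ed k : damp lam a k x - k%:~R * amp lam a k x = gauss lam x *
    ((slope lam x - k%:~R) * bump a (slope lam x - k%:~R) -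
      lam * dbump a (slope lam x - k%:~R)) by rewrite /damp /amp; ring.
rewrite !Ed /amp !exprMn -!mulrDr [leRHS]mulrCA ler_wpM2l ?sqr_ge0//.
have m1 := mode_le1 false (slope lam x); have n1 := mode_le1 true (slope lam x).
apply: (@bump_ineq _ a _ _ _ e); rewrite ?bump_ge0_le1 ?bump_mul_le ?dbump_le4//.
have [[] h] := mode_near_half (slope lam x); [right|left]; exact: he.
Qed.

Lemma spinor_neq0 (a e lam : R) : 0 < e ->
  (forall s, `|s| <= 1 / 2 -> e <= bump a s) ->
  forall x : R * R, x != 0 -> spinor lam a x != 0.
Proof.
move=> e0 he x x0; apply/eqP => u0.
have := norm_spinor lam a x0; rewrite u0 norm_C2_sqr !mxE /= expr0n !addr0 /=.
have pos p : `|slope lam x - (mode p (slope lam x))%:~R| <= 1 / 2 ->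
    0 < amp lam a (mode p (slope lam x)) x ^+ 2.
  move=> /he h; rewrite exprn_gt0// mulr_gt0 ?gauss_gt0//.
  exact: lt_le_trans h.
have sq0 p := sqr_ge0 (amp lam a (mode p (slope lam x)) x).
have [[] /pos h] := mode_near_half (slope lam x) => /esym/eqP;
  by rewrite gt_eqF// ?(ltr_pwDl h)// (ltr_wpDl _ h).
Qed.

End DiracBound.

(** * Integration on the plane and weak derivatives *)

Section Measure.
Set Implicit Arguments.
Unset Strict Implicit.
Context {R : realType}.
Implicit Types (f g : R * R -> R).
Let mu := @lebesgue_measure R.
Let T2 := (measurableTypeR R * measurableTypeR R)%type.

(** An open set is the union of the boxes with rational endpoints contained in it, and these are
    countably many. *)
Lemma open_measurable2 (U : set (R * R)) : open U ->
  measurable (U : set T2).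
Proof.
move=> oU.
pose I := ((rat * rat) * (rat * rat))%type.
pose box (i : I) : set T2 :=
  `]ratr i.1.1, ratr i.1.2[%classic `*` `]ratr i.2.1, ratr i.2.2[%classic.
pose F (i : I) : set T2 := if `[< box i `<=` U >] then box i else set0.
rewrite (_ : U = \bigcup_i F i); last first.
  apply/seteqP; split => [[x y] Uxy|[x y] [i _]]; last first.
    by rewrite /F; case: ifPn => [/asboolP|//]; exact.
  have := oU; rewrite openE => /(_ _ Uxy) /nbhs_ballP[e /= e0 eU].
  have /rat_in_itvoo[p1 /[!in_itv]/= /andP[p1xl p1xr]] : x - e < x
    by rewrite ltrBlDr ltrDl.
  have /rat_in_itvoo[p2 /[!in_itv]/= /andP[p2xl p2xr]] : x < x + e by rewrite ltrDl.
  have /rat_in_itvoo[q1 /[!in_itv]/= /andP[q1yl q1yr]] : y - e < y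
    by rewrite ltrBlDr ltrDl.
  have /rat_in_itvoo[q2 /[!in_itv]/= /andP[q2yl q2yr]] : y < y + e by rewrite ltrDl.
  exists ((p1, p2), (q1, q2)) => //; rewrite /F ifT.
    by split; rewrite /= in_itv /=; apply/andP.
  apply/asboolP => -[x' y'] [] /=; rewrite !in_itv /= => /andP[h1 h2] /andP[h3 h4].
  apply: eU; split; rewrite /ball /= ltr_norml.
    move: (ratr _) (ratr _) p1xl p2xr h1 h2 => r s ? ? ? ?.
    by apply/andP; split; lra.
  move: (ratr _) (ratr _) q1yl q2yr h3 h4 => r s ? ? ? ?.
  by apply/andP; split; lra.
apply: countable_bigcupT_measurable => [|i]; first exact: countableP.
rewrite /F; case: ifPn => _ //; apply: measurableX; exact: measurable_itv.
Qed.

Lemma continuous_measurable2 f : continuous f -> measurable_fun [set: T2] f.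
Proof.
move=> /continuousP cf; apply: (measurability _ (RGenOpens.measurableE R)).
move=> _ [_ [a [b ->] <-]]; rewrite setTI; apply: open_measurable2.
exact/cf/interval_open.
Qed.

Lemma oneDsqrV_ge0 (x : R) : 0 <= (oneDsqr x)^-1.
Proof. by rewrite invr_ge0 ltW. Qed.

(** An integrable function to dominate all integrands. The product form reduces its integral to two
    copies of that of [1 / (1 + x^2)]. *)
Definition weight (x : R * R) : R := (oneDsqr x.1)^-1 * (oneDsqr x.2)^-1.

Lemma weight_ge0 x : 0 <= weight x.
Proof. by rewrite mulr_ge0// oneDsqrV_ge0. Qed.

Lemma integral_oneDsqrV : (\int[mu]_x (oneDsqr x)^-1%:E = pi%:E)%E.
Proof.
rewrite (@ge0_symfun_integralT _ (fun x => (oneDsqr x)^-1)).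
- rewrite -set_itvcy integral0y_oneDsqr -EFinM; congr EFin; by field.
- exact: oneDsqrV_ge0.
- exact: continuous_oneDsqrV.
- by move=> x; rewrite /= /oneDsqr sqrrN.
Qed.

Lemma measurable_weight : measurable_fun [set: T2] weight.
Proof.
apply: continuous_measurable2 => x.
apply: (@continuousM R (R * R)%type (fun y => (oneDsqr y.1)^-1)
  (fun y => (oneDsqr y.2)^-1)).
  apply: (@continuous_comp _ _ _ (fun y : R * R => y.1) (fun r => (oneDsqr r)^-1)).
    by case: x => a b; apply: cvg_fst.
  exact: continuous_oneDsqrV.
apply: (@continuous_comp _ _ _ (fun y : R * R => y.2) (fun r => (oneDsqr r)^-1)).
  by case: x => a b; apply: cvg_snd.
exact: continuous_oneDsqrV.
Qed.

Lemma integrable_weight : lebesgue2.-integrable [set: T2] (EFin \o weight).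
Proof.
have mw : measurable_fun [set: T2] (EFin \o weight).
  apply/measurable_EFinP; exact: measurable_weight.
apply: (@integrable12ltyP _ _ _ _ R (@lebesgue_measure R)
  (@lebesgue_measure R) _ mw).2.
have mo : measurable_fun [set: R] (fun x : R => (oneDsqr x)^-1).
  by apply: continuous_measurable_fun; exact: continuous_oneDsqrV.
have inner (x : R) : (\int[mu]_y `|(EFin \o weight) (x, y)| =
    (pi * (oneDsqr x)^-1)%:E)%E.
  transitivity (\int[mu]_y ((oneDsqr x)^-1%:E * (oneDsqr y)^-1%:E))%E.
    by apply: eq_integral => y _; rewrite /= ger0_norm ?weight_ge0.
  rewrite ge0_integralZl_EFin//= ?oneDsqrV_ge0//.
  - by rewrite integral_oneDsqrV -EFinM mulrC.
  - exact/measurable_EFinP.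
rewrite [ltLHS](_ : _ = \int[mu]_x (pi%:E * (oneDsqr x)^-1%:E))%E; last first.
  by apply: eq_integral => x _; rewrite inner.
rewrite ge0_integralZl_EFin//= ?pi_ge0//.
- by rewrite integral_oneDsqrV -EFinM ltry.
- exact/measurable_EFinP.
Qed.

Lemma integrable_dominated f (K : R) : measurable_fun [set: T2] f ->
  (forall x, `|f x| <= K * weight x) ->
  lebesgue2.-integrable [set: T2] (EFin \o f).
Proof.
move=> mf fK.
have iw : lebesgue2.-integrable [set: T2] (EFin \o (fun x => K * weight x)).
  rewrite (_ : _ \o _ = (fun x : T2 => K%:E * (EFin \o weight) x)%E)//.
  by apply: integrableZl => //; exact: integrable_weight.
apply: (le_integrable measurableT _ _ iw); first exact/measurable_EFinP.
by move=> x _; rewrite /= lee_fin; apply: le_trans (fK x) _; exact: ler_norm.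
Qed.

Lemma Lfun2_dominated f (K : R) : measurable_fun [set: T2] f ->
  (forall x, `|f x| <= K * weight x) -> f \in Lfun lebesgue2 2%:E.
Proof.
move=> mf fK; rewrite inE /=; apply/andP; split; rewrite inE//=.
rewrite /finite_norm unlock /= poweR_lty//.
have : lebesgue2.-integrable [set: T2] (EFin \o (fun x => f x ^+ 2)).
  apply: (@integrable_dominated _ (K ^+ 2)); first exact: measurable_funX.
  move=> x; rewrite normrX.
  (* Because of this bound [weight^2 <= weight], so the square is integrable as well. *)
  have w1 : weight x <= 1.
    by rewrite mulr_ile1 ?oneDsqrV_le1 ?oneDsqrV_ge0.
  apply: (@le_trans _ _ (K ^+ 2 * weight x ^+ 2)).
    rewrite -exprMn lerXn2r ?fK// nnegrE//.
    by apply: le_trans (fK x).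
  by rewrite ler_wpM2l ?sqr_ge0// expr2 ler_piMr// weight_ge0.
move=> /integrableP[_]; apply: le_lt_trans.
rewrite le_eqVlt; apply/orP; left; apply/eqP; apply: eq_integral => x _.
by rewrite /= powR_mulrn// normrX.
Qed.

Lemma integral_derive_compact (h h' : R -> R) (M : R) : 0 < M ->
  (forall x, is_derive x (1 : R) h (h' x)) -> continuous h' ->
  (forall x, M <= `|x| -> h x = 0 /\ h' x = 0) ->
  (\int[mu]_x (h' x)%:E = 0)%E.
Proof.
move=> M0 dh ch' h0.
have dhx x : derivable h x 1 by have [] := dh x.
have ch : continuous h.
  by move=> x; apply/differentiable_continuous/derivable1_diffP.
transitivity (\int[mu]_(x in `[(- M)%R, M]) (h' x)%:E)%E.
  rewrite [RHS]integral_mkcond; apply: eq_integral => x _; rewrite patchE.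
  case: ifPn => // /negP xM; rewrite (h0 x _).2//.
  rewrite leNgt; apply/negP => xM'; apply: xM; rewrite inE /= in_itv /=.
  by rewrite -ler_norml ltW.
rewrite (@continuous_FTC2 _ _ h).
- rewrite (h0 M _).1 ?(h0 (- M) _).1 ?subee// ?normrN ger0_norm// ltW//.
- by rewrite (@lt_trans _ _ 0)// oppr_lt0.
- exact: continuous_subspaceT.
- split => [x _//||].
    by apply: cvg_at_right_filter; exact: ch.
  by apply: cvg_at_left_filter; exact: ch.
- by move=> x _; rewrite derive1E; have [_ ->] := dh x.
Qed.

Lemma is_derive_section f (x : R * R) (d : R) k :
  is_derive x (basis_vec k) f d ->
  is_derive (if k == 0 then x.1 else x.2) (1 : R)
    (fun t => f (if k == 0 then (t, x.2) else (x.1, t))) d.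
Proof.
case: x => x y /= [df <-].
set v := basis_vec k; set z := if _ then _ else _; set g := fun t : R => _.
have E : (fun h : R => h^-1 *: ((g \o shift z) (h *: (1 : R)) - g z)) =
    (fun h : R => h^-1 *: ((f \o shift (x, y)) (h *: v) - f (x, y))).
  apply/funext => h; rewrite /g /z /v /basis_vec /= [h *: 1]mulr1.
  congr (_ *: (f _ - f _)); last by case: (k == 0).
  by case: (k == 0); apply/pair_equal_spec; split;
    rewrite /= /GRing.scale /= ?mulr1 ?mulr0 ?add0r.
by split; rewrite /derivable /derive E.
Qed.

Lemma test_function_bounds (phi : R * R -> R) : test_function phi ->
  exists2 B, 0 <= B & exists2 M, 0 < M & forall x,
    [/\ `|phi x| <= B, forall k, `|'D_(basis_vec k) phi x| <= B &
      M <= `|x| -> phi x = 0 /\ forall k, 'D_(basis_vec k) phi x = 0].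
Proof.
move=> [sphi cA]; set A := closure _ in cA.
have cphi : continuous phi by move=> x; have [] := sphi [::] x I.
have cdphi k : continuous ('D_(basis_vec k) phi).
  by move=> x; have [] := sphi [:: k] x I.
(* The complement of the closed support is open, so [phi] vanishes near [x] and its derivatives
   vanish at [x]. *)
have out x : ~ A x -> phi x = 0 /\ forall k, 'D_(basis_vec k) phi x = 0.
  move=> nAx; have near0 : \forall y \near x, phi y = 0.
    have oA : open (~` A) by exact/closed_openC/closed_closure.
    have := open_nbhs_nbhs (conj oA nAx); apply: filterS => y nAy.
    by apply/eqP/negPn/negP => py; apply: nAy; exact: subset_closure.
  split; first exact: (nbhs_singleton near0).
  move=> k; rewrite -[RHS](derive_cst (0 : R) x (basis_vec k)).
  exact: near_eq_derive.
have bnd (f : R * R -> R) : continuous f -> (forall x, ~ A x -> f x = 0) ->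
    exists2 B, 0 <= B & forall x, `|f x| <= B.
  move=> cf f0.
  have : compact (f @` A).
    by apply: continuous_compact => //; exact: continuous_subspaceT.
  move=> /compact_bounded[N [_ HN]].
  exists (`|N| + 1); first by rewrite addr_ge0.
  move=> x; have [Ax|/f0 ->] := pselect (A x); last by rewrite normr0 addr_ge0.
  by apply: HN; [rewrite (le_lt_trans (ler_norm _))// ltrDl|exists x].
have [B0 B00 HB0] := bnd _ cphi (fun x nA => (out x nA).1).
have HB k := bnd _ (cdphi k) (fun x nA => (out x nA).2 k).
have [B1 B10 HB1] := HB 0; have [B2 B20 HB2] := HB 1.
have [N [_ HN]] := compact_bounded cA.
exists (B0 + B1 + B2); first by rewrite !addr_ge0.
(* Every number above [N] bounds the norm on the support, in particular [|N| + 1]; so points of norm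
   at least [|N| + 2] lie outside. *)
exists (`|N| + 2); first by rewrite ltr_wpDl.
move=> x; split.
- by apply: le_trans (HB0 x) _; rewrite -addrA lerDl addr_ge0.
- move=> [[|[|//]] i].
  + rewrite (_ : Ordinal i = 0); last exact/val_inj.
    by apply: le_trans (HB1 x) _; rewrite addrAC lerDr addr_ge0.
  + rewrite (_ : Ordinal i = 1); last exact/val_inj.
    by apply: le_trans (HB2 x) _; rewrite lerDr addr_ge0.
- move=> Mx; apply: out => Ax.
  have := HN (`|N| + 1) _ x Ax; rewrite (le_lt_trans (ler_norm _)) ?ltrDl//.
  by move=> /(_ isT) h; have := le_trans Mx h; lra.
Qed.

Lemma continuous_pairl (y : R) : continuous (fun x : R => (x, y)).
Proof. by move=> x; exact: (cvg_pair cvg_id (cvg_cst y)). Qed.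

Lemma continuous_pairr (x : R) : continuous (fun y : R => (x, y)).
Proof. by move=> y; exact: (cvg_pair (cvg_cst x) cvg_id). Qed.

(** Fubini, with the inner integral taken along direction [k]: it vanishes by the fundamental
    theorem of calculus. The choice of [k] decides the order of integration. *)
Lemma integral_partial_eq0 (h : R * R -> R) (dh : R * R -> R) (k : 'I_2) (M K : R) :
  0 < M -> (forall x, is_derive x (basis_vec k) h (dh x)) -> continuous dh ->
  (forall x, M <= `|x| -> h x = 0 /\ dh x = 0) ->
  (forall x, `|dh x| <= K * weight x) ->
  (\int[lebesgue2]_x (dh x)%:E = 0)%E.
Proof.
move=> M0 Dh cdh h0 dhK.
have idh := integrable_dominated (continuous_measurable2 cdh) dhK.
have normx (x y : R) : `|x| <= `|(x, y)| /\ `|y| <= `|(x, y)|.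
  by rewrite prod_normE /= !le_max !lexx orbT.
case: k Dh => [[|[|//]] i] Dh.
- apply: (eq_trans (esym (@integral21_prod_meas1 _ _ _ _ R (@lebesgue_measure R)
    (@lebesgue_measure R) _ idh))).
  apply: integral0_eq => y _.
  apply: (@integral_derive_compact (fun x => h (x, y)) (fun x => dh (x, y)) M) => //.
  + by move=> x; exact: (is_derive_section (Dh (x, y))).
  + move=> x; apply: (@continuous_comp _ _ _ (fun x : R => (x, y)) dh) => //.
    exact: continuous_pairl.
    exact: cdh.
  + by move=> t Mt; apply: h0; apply: le_trans Mt _; have [] := normx t y.
- apply: (eq_trans (esym (@integral12_prod_meas1 _ _ _ _ R (@lebesgue_measure R)
    (@lebesgue_measure R) _ idh))).
  apply: integral0_eq => x _.
  apply: (@integral_derive_compact (fun y => h (x, y)) (fun y => dh (x, y)) M) => //.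
  + by move=> y; exact: (is_derive_section (Dh (x, y))).
  + move=> y; apply: (@continuous_comp _ _ _ (fun y : R => (x, y)) dh) => //.
    exact: continuous_pairr.
    exact: cdh.
  + by move=> t Mt; apply: h0; apply: le_trans Mt _; have [] := normx x t.
Qed.

(** The classical partial derivative is the weak one, since the derivative of [f * phi] has integral
    zero. Domination by [weight] supplies the integrability. *)
Lemma sobolev_H1_C1 f (df : 'I_2 -> R * R -> R) (K : R) :
  continuous f -> (forall k, continuous (df k)) ->
  (forall k x, is_derive x (basis_vec k) f (df k x)) ->
  (forall x, `|f x| <= K * weight x) ->
  (forall k x, `|df k x| <= K * weight x) -> sobolev_H1 f.
Proof.
move=> cf cdf Df fK dfK.
have mf := continuous_measurable2 cf.
split; first exact: Lfun2_dominated fK.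
move=> k; have mdf := continuous_measurable2 (cdf k).
exists (df k); first exact: Lfun2_dominated (dfK k).
move=> phi tphi; have [B B0 [M M0 HBM]] := test_function_bounds tphi.
have cphi : continuous phi by move=> x; have [] := tphi.1 [::] x I.
have cdphi : continuous ('D_(basis_vec k) phi).
  by move=> x; have [] := tphi.1 [:: k] x I.
have Dphi x : is_derive x (basis_vec k) phi ('D_(basis_vec k) phi x).
  by have [_ /(_ k)] := tphi.1 [::] x I; exact: derivableP.
have K0 x : 0 <= K * weight x by exact: le_trans (fK x).
have bound (g p : R * R -> R) : (forall x, `|g x| <= K * weight x) ->
    (forall x, `|p x| <= B) -> forall x, `|g x * p x| <= (B * K) * weight x.
  move=> gK pB x; rewrite normrM mulrC -mulrA.
  exact: ler_pM.
have pB x : `|phi x| <= B by case: (HBM x).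
have dpB x : `|'D_(basis_vec k) phi x| <= B by case: (HBM x).
have b1 := bound _ _ fK dpB.
have b2 := bound _ _ (dfK k) pB.
have c1 : continuous (fun x => f x * 'D_(basis_vec k) phi x).
  by move=> x; exact: (continuousM (cf x) (cdphi x)).
have c2 : continuous (fun x => df k x * phi x).
  by move=> x; exact: (continuousM (cdf k x) (cphi x)).
have i1 := integrable_dominated (continuous_measurable2 c1) b1.
have i2 := integrable_dominated (continuous_measurable2 c2) b2.
apply/eqP; rewrite -addr_eq0 -RintegralD//; apply/eqP.
rewrite /Rintegral.
have Dh x : is_derive x (basis_vec k) (fun x => f x * phi x)
    (f x * 'D_(basis_vec k) phi x + df k x * phi x).
  apply: is_derive_eq (is_deriveM (Df k x) (Dphi x)) _.
  by rewrite /GRing.scale /= [phi x * _]mulrC.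
rewrite (integral_partial_eq0 (K := B * K + B * K) M0 Dh)//.
- by move=> x; exact: (continuousD (c1 x) (c2 x)).
- move=> x Mx; have [_ _ /(_ Mx)[p0 dp0]] := HBM x.
  by rewrite p0 dp0 !mulr0 addr0.
- move=> x; rewrite mulrDl; apply: le_trans (ler_normD _ _) _.
  by apply: lerD; [exact: b1|exact: b2].
Qed.

End Measure.

(** * Decay at the origin and at infinity *)

Section Assembly.
Set Implicit Arguments.
Unset Strict Implicit.
Context {R : realType} (lam a : R).
Context (lam01 : 0 < lam <= 1) (a01 : 0 <= a < 1).
Implicit Types (x : R * R) (k : 'I_2) (p b : bool).

Let lam_ge0 : 0 <= lam <= 1. Proof. by move: lam01 => /andP[/ltW -> ->]. Qed.

(** One function dominating both the waves and their gradients: the last factor covers the [1] of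
    the former and the [1 / |x|] of the latter. *)
Definition majorant x : R :=
  gauss lam x * (2 * `|lnr x| + 5) * (1 + expR (- lnr x)).

Lemma gauss_le_majorant x : gauss lam x <= majorant x.
Proof.
rewrite /majorant -mulrA ler_peMr ?ltW ?gauss_gt0//.
have := normr_ge0 (lnr x); have := expR_ge0 (- lnr x); nra.
Qed.

Lemma majorant_ge0 x : 0 <= majorant x.
Proof. exact: le_trans (ltW (gauss_gt0 lam x)) (gauss_le_majorant x). Qed.

Lemma wave_majorant p b x : `|wave lam a p b x| <= majorant x.
Proof.
have [->|x0] := eqVneq x 0.
  by rewrite /wave eqxx normr0 majorant_ge0.
exact: le_trans (wave_le lam a p b x0) (gauss_le_majorant x).
Qed.

Lemma dwave_majorant p b k x : `|dwave lam a p b k x| <= majorant x.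
Proof.
have [->|x0] := eqVneq x 0.
  by rewrite /dwave eqxx normr0 majorant_ge0.
apply: le_trans (dwave_le a p b k lam_ge0 x0) _.
by rewrite /majorant ler_wpM2l ?lerDr// mulr_ge0 ?addr_ge0 ?mulr_ge0// ltW ?gauss_gt0.
Qed.

Lemma majorant_decay (B : R) : exists2 K, 0 <= K & forall x, x != 0 ->
  majorant x <= K * expR (B * lnr x) * weight x.
Proof.
have l0 : 0 < lam by case/andP: lam01.
have main (B' : R) : exists2 K, 0 <= K &
    forall x, majorant x <= K * expR (B' * lnr x).
  (* The summand [expR (- lnr x)] of [majorant] costs one power of [|x|], hence the exponent
     [B' + 1]. *)
  have [K1 K10 H1] := gauss_decay B' l0; have [K2 K20 H2] := gauss_decay (B' + 1) l0.
  exists (K1 + K2); first exact: addr_ge0.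
  move=> x; rewrite /majorant mulrDr mulr1 [leRHS]mulrDl lerD//.
  apply: (@le_trans _ _ (K2 * expR ((B' + 1) * lnr x) * expR (- lnr x))).
    by rewrite ler_wpM2r ?expR_ge0.
  by rewrite -mulrA -expRD mulrDl mul1r addrK.
(* The inverse of [weight] is at most [(1 + |x|^2)^2]; the exponents [B], [B - 2], [B - 4] treat its
   terms [1], [2 |x|^2], [|x|^4]. *)
have [K0 K00 H0] := main B; have [K1 K10 H1] := main (B - 2).
have [K2 K20 H2] := main (B - 4).
exists (K0 + 2 * K1 + K2); first by rewrite !addr_ge0 ?mulr_ge0.
move=> x x0; set w := (1 + x.1 ^+ 2) * (1 + x.2 ^+ 2).
have w0 : 0 < w by rewrite mulr_gt0// ltr_pwDl// sqr_ge0.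
have -> : weight x = w^-1 by rewrite /weight /w invfM.
rewrite ler_pdivlMr//.
have wE : w <= (1 + sqr_norm x) ^+ 2.
  rewrite /w /sqr_norm; have := sqr_ge0 x.1; have := sqr_ge0 x.2.
  by move: (x.1 ^+ 2) (x.2 ^+ 2) => u v u0 v0; nra.
have M0 := majorant_ge0 x.
apply: (@le_trans _ _ (majorant x * (1 + sqr_norm x) ^+ 2)).
  by rewrite ler_wpM2l.
rewrite -expR_2lnr//; set e2 := expR (2 * lnr x).
have e4 : e2 ^+ 2 = expR (4 * lnr x) by rewrite expr2 -expRD; congr expR; ring.
have h1 : majorant x * e2 <= K1 * expR (B * lnr x).
  have -> : expR (B * lnr x) = expR ((B - 2) * lnr x) * e2.
    by rewrite -expRD; congr expR; ring.
  by rewrite [leRHS]mulrA; apply: ler_wpM2r (H1 x); exact: expR_ge0.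
have h2 : majorant x * e2 ^+ 2 <= K2 * expR (B * lnr x).
  have -> : expR (B * lnr x) = expR ((B - 4) * lnr x) * e2 ^+ 2.
    by rewrite e4 -expRD; congr expR; ring.
  by rewrite [leRHS]mulrA; apply: ler_wpM2r (H2 x); exact: sqr_ge0.
have h0 := H0 x.
have -> : majorant x * (1 + e2) ^+ 2 =
  majorant x + 2 * (majorant x * e2) + majorant x * e2 ^+ 2 by ring.
have -> : (K0 + 2 * K1 + K2) * expR (B * lnr x) =
  K0 * expR (B * lnr x) + 2 * (K1 * expR (B * lnr x)) + K2 * expR (B * lnr x) by ring.
by rewrite !lerD// ler_pM2l.
Qed.

Lemma weight_le1 x : weight x <= 1.
Proof. by rewrite mulr_ile1 ?oneDsqrV_le1 ?oneDsqrV_ge0. Qed.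

(** Decay with exponent [2]. It makes the waves and their gradients continuous at the origin and
    gives the waves zero derivative there. *)
Lemma sqr_norm_bound : exists2 K, 0 <= K & forall f : R * R -> R,
  (forall x, `|f x| <= majorant x) -> f 0 = 0 ->
  forall x, `|f x| <= K * sqr_norm x.
Proof.
have [K K0 HK] := majorant_decay 2; exists K => // f fM f0 x.
have [->|x0] := eqVneq x 0.
  by rewrite f0 normr0 mulr_ge0// addr_ge0 ?sqr_ge0.
apply: le_trans (fM x) _; apply: le_trans (HK x x0) _.
by rewrite expR_2lnr// ler_piMr ?weight_le1// mulr_ge0// ltW// sqr_norm_gt0.
Qed.

(** Decay with exponent [0], which yields the domination needed for [H^1]. *)
Lemma weight_bound : exists2 K, 0 <= K & forall f : R * R -> R,
  (forall x, `|f x| <= majorant x) -> f 0 = 0 -> forall x, `|f x| <= K * weight x.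
Proof.
have [K K0 HK] := majorant_decay 0; exists K => // f fM f0 x.
have [->|x0] := eqVneq x 0; first by rewrite f0 normr0 mulr_ge0// weight_ge0.
by apply: le_trans (fM x) _; apply: le_trans (HK x x0) _; rewrite mul0r expR0 mulr1.
Qed.

Lemma continuous_sqr_norm : continuous (@sqr_norm R).
Proof.
move=> x; exact: (continuousD (continuousM (@continuous_fstR R x) (@continuous_fstR R x))
  (continuousM (@continuous_sndR R x) (@continuous_sndR R x))).
Qed.

Lemma sqr_norm_bound_continuous (f : R * R -> R) (K : R) : f 0 = 0 ->
  (forall x, `|f x| <= K * sqr_norm x) -> {for 0, continuous f}.
Proof.
move=> f0 fK; rewrite /prop_for /continuous_at f0; apply/cvgr0Pnorm_lt => e e0.
have K1 : 0 < `|K| + 1 by rewrite ltr_wpDl.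
have n0 : sqr_norm (0 : R * R) = 0 by rewrite /sqr_norm /= expr0n addr0.
have : sqr_norm x @[x --> (0 : R * R)] --> sqr_norm (0 : R * R).
  exact: continuous_sqr_norm.
rewrite n0.
move=> /cvgr0Pnorm_lt /(_ (e / (`|K| + 1)) (divr_gt0 e0 K1)).
apply: filterS => x; rewrite ltr_pdivlMr// mulrC; apply: le_lt_trans.
apply: le_trans (fK x) _; have s0 : 0 <= sqr_norm x by rewrite addr_ge0 ?sqr_ge0.
by rewrite (ger0_norm s0) ler_wpM2r// (le_trans (ler_norm _))// lerDl.
Qed.

Lemma sqr_norm_bound_derive (f : R * R -> R) (K : R) k : f 0 = 0 ->
  (forall x, `|f x| <= K * sqr_norm x) -> is_derive 0 (basis_vec k) f 0.
Proof.
move=> f0 fK; apply/is_derive_lineP; apply: (@is_derive_sqr_bound _ _ _ K).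
  by rewrite scale0r addr0.
move=> r; rewrite addr0 subr0; apply: le_trans (fK _) _.
by rewrite /sqr_norm /basis_vec; case: ifP => _;
  rewrite /GRing.scale /= /GRing.scale /= mulr1 mulr0 expr0n ?addr0 ?add0r.
Qed.

Lemma wave0 p b : wave lam a p b 0 = 0. Proof. by rewrite /wave eqxx. Qed.

Lemma dwave0 p b k : dwave lam a p b k 0 = 0. Proof. by rewrite /dwave eqxx. Qed.

Lemma continuous_wave p b : continuous (wave lam a p b).
Proof.
move=> x; have [->|x0] := eqVneq x 0.
  have [K K0 HK] := sqr_norm_bound.
  exact: sqr_norm_bound_continuous (wave0 p b) (HK _ (wave_majorant p b) (wave0 p b)).
exact: (ck_on_continuous (ck_on_wave lam 0%N p b a01) (elimN eqP x0)).
Qed.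

Lemma continuous_dwave p b k : continuous (dwave lam a p b k).
Proof.
move=> x; have [->|x0] := eqVneq x 0.
  have [K K0 HK] := sqr_norm_bound.
  exact: sqr_norm_bound_continuous (dwave0 p b k)
    (HK _ (dwave_majorant p b k) (dwave0 p b k)).
have cw : ck_on punctured 0%N ('D_(basis_vec k) (wave lam a p b)).
  by have [_ /(_ k)[]] := ck_on_wave lam 1%N p b a01.
suff cd : ck_on punctured 0%N (dwave lam a p b k).
  exact: (ck_on_continuous cd (elimN eqP x0)).
apply: (ck_on_eq (@open_punctured R) _ cw) => y /[!inE] /eqP y0.
exact: (@derive_val _ _ _ _ _ _ _ (is_derive_wave lam p b k a01 y0)).
Qed.

Lemma is_derive_waveT p b k x :
  is_derive x (basis_vec k) (wave lam a p b) (dwave lam a p b k x).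
Proof.
have [->|x0] := eqVneq x 0; last exact: is_derive_wave.
have [K K0 HK] := sqr_norm_bound; rewrite dwave0.
exact: sqr_norm_bound_derive (wave0 p b) (HK _ (wave_majorant p b) (wave0 p b)).
Qed.

Lemma sobolev_wave (c : R) p b : sobolev_H1 (fun x => c * wave lam a p b x).
Proof.
have [K K0 HK] := weight_bound.
apply: (@sobolev_H1_C1 _ _ (fun k x => c * dwave lam a p b k x) (`|c| * K)).
- move=> x; apply: continuousM; [exact: cst_continuous|exact: continuous_wave].
- move=> k x; apply: continuousM; [exact: cst_continuous|exact: continuous_dwave].
- move=> k x; exact: (is_deriveZ c (is_derive_waveT p b k x)).
- move=> x; rewrite normrM -mulrA ler_wpM2l//.
  exact: HK (wave_majorant p b) (wave0 p b) x.
- move=> k x; rewrite normrM -mulrA ler_wpM2l//.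
  exact: HK (dwave_majorant p b k) (dwave0 p b k) x.
Qed.

(** The real and imaginary parts are waves up to sign; the scalar [c] accounts for the conjugation
    in the second component. *)
Lemma componentwise_spinor (P : (R * R -> R) -> Prop) :
  (forall c p b, P (fun x => c * wave lam a p b x)) ->
  componentwise P (spinor lam a).
Proof.
move=> HP j; rewrite /spinor.
have HP1 p b : P (wave lam a p b).
  by have := HP 1 p b; under eq_fun do rewrite mul1r.
have HPN p b : P (fun x => - wave lam a p b x).
  by have := HP (-1) p b; under eq_fun do rewrite mulN1r.
by split; under eq_fun do rewrite mxE; case: (j == 0);
  first [exact: HP1 | exact: HPN].
Qed.

Lemma norm_spinor0 : norm_C2 (spinor lam a 0) ^+ 2 = 0.
Proof. by rewrite norm_C2_sqr !spinor_components !wave0 oppr0 expr0n /= !addr0. Qed.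

Lemma norm_spinor_le x : norm_C2 (spinor lam a x) ^+ 2 <= 2 * majorant x.
Proof.
have [->|x0] := eqVneq x 0.
  by rewrite norm_spinor0 mulr_ge0 ?majorant_ge0.
have gM := gauss_le_majorant x; have g0 := gauss_gt0 lam x.
have g1 : gauss lam x <= 1.
  rewrite /gauss -expR0 ler_expR mulNr mulNr oppr_le0.
  by rewrite divr_ge0// mulr_ge0 ?sqr_ge0//; case/andP: lam_ge0.
have le m : amp lam a m x ^+ 2 <= majorant x.
  apply: le_trans gM; rewrite /amp; set s := slope _ _ - _.
  have /andP[b0 b1] := bump_ge0_le1 a s.
  apply: (@le_trans _ _ (gauss lam x * bump a s)).
    by rewrite expr2 ler_piMr ?mulr_ge0// ?mulr_ile1// ltW.
  by rewrite ler_piMr// ltW.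
by rewrite norm_spinor// mulr_natl mulr2n lerD.
Qed.

Lemma continuous_norm_spinor : continuous (fun x => norm_C2 (spinor lam a x) ^+ 2).
Proof.
have -> : (fun x => norm_C2 (spinor lam a x) ^+ 2) = fun x =>
    (wave lam a false false x * wave lam a false false x +
     wave lam a false true x * wave lam a false true x) +
    (wave lam a true false x * wave lam a true false x +
     wave lam a true true x * wave lam a true true x).
  by apply/funext => x; rewrite norm_C2_sqr !spinor_components sqrrN !expr2.
have c p b x := continuousM (@continuous_wave p b x) (@continuous_wave p b x).
move=> x; exact: (continuousD (continuousD (c _ _ x) (c _ _ x))
  (continuousD (c _ _ x) (c _ _ x))).
Qed.

(** Decay with exponent [n] bounds [|u|^2] by a constant times [|x|^n * weight x]; on the disc
    [|x|^n <= r^n], and [weight] is integrable. *)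
Lemma integral_norm_spinor_le (n : nat) : exists2 K, 0 <= K & forall r, 0 < r ->
  (\int[@lebesgue2 R]_(x in [set x | (norm_R2 x < r)%R])
    (norm_C2 (spinor lam a x) ^+ 2)%:E <= (K * r ^+ n)%:E)%E.
Proof.
have [K K0 HK] := majorant_decay n%:R.
have W : (\int[@lebesgue2 R]_x (weight x)%:E)%E \is a fin_num.
  exact: (integrable_fin_num measurableT (@integrable_weight R)).
have W0 : (0 <= \int[@lebesgue2 R]_x (weight x)%:E)%E.
  by apply: integral_ge0 => x _; rewrite lee_fin weight_ge0.
exists (2 * K * fine (\int[@lebesgue2 R]_x (weight x)%:E)%E).
  by rewrite !mulr_ge0// fine_ge0.
move=> r r0; set S := [set x | _].
have pt x : S x -> norm_C2 (spinor lam a x) ^+ 2 <= 2 * K * r ^+ n * weight x.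
  rewrite /S /= => xr; have [x_0|x0] := eqVneq x 0.
    rewrite x_0 norm_spinor0.
    by rewrite !mulr_ge0 ?exprn_ge0 ?weight_ge0// ltW.
  apply: le_trans (norm_spinor_le x) _; rewrite -!mulrA ler_pM2l//.
  apply: le_trans (HK x x0) _; rewrite -!mulrA ler_wpM2l// ler_wpM2r ?weight_ge0//.
  rewrite expRM_natl -norm_R2E//; apply: lerXn2r; rewrite ?nnegrE ?sqrtr_ge0 ?ltW//.
have cR : continuous (@norm_R2 R).
  move=> x; apply: (@continuous_comp _ _ _ (@sqr_norm R) (@Num.sqrt R)).
    exact: continuous_sqr_norm.
  exact: sqrt_continuous.
have mS : measurable (S : set (measurableTypeR R * measurableTypeR R)).
  apply: open_measurable2.
  rewrite (_ : S = @norm_R2 R @^-1` [set y | y < r])//.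
  by apply: open_comp; [move=> x _; exact: cR|exact: open_lt].
have mw := @measurable_weight R.
have c0 : 0 <= 2 * K * r ^+ n by rewrite !mulr_ge0 ?exprn_ge0// ltW.
have w0 (x : R * R) : 0 <= 2 * K * r ^+ n * weight x by rewrite mulr_ge0// weight_ge0.
have mc : measurable_fun [set: measurableTypeR R * measurableTypeR R]
    (fun x => 2 * K * r ^+ n * weight x) by exact: measurable_funM.
apply: (@le_trans _ _ (\int[@lebesgue2 R]_(x in S) (2 * K * r ^+ n * weight x)%:E)%E).
  apply: ge0_le_integral => //.
  - by move=> x _; rewrite lee_fin sqr_ge0.
  - apply/measurable_EFinP; apply: measurable_funTS.
    by apply: continuous_measurable2; exact: continuous_norm_spinor.
  - by apply/measurable_EFinP; exact: measurable_funTS.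
apply: (@le_trans _ _ (\int[@lebesgue2 R]_x (2 * K * r ^+ n * weight x)%:E)%E).
  apply: ge0_subset_integral => //; first exact/measurable_EFinP.
  by move=> x _; rewrite lee_fin.
under eq_integral => x _ do rewrite EFinM.
rewrite ge0_integralZl_EFin//.
- rewrite -(fineK W) -EFinM lee_fin le_eqVlt; apply/orP; left; apply/eqP.
  by rewrite /=; ring.
- by move=> x _; rewrite lee_fin weight_ge0.
- exact/measurable_EFinP.
Qed.

Lemma vanishes_spinor : vanishes_infinite_order (spinor lam a).
Proof.
(* One power more than [n] leaves the bound [K * r], which tends to [0]. *)
move=> n; have [K K0 HK] := integral_norm_spinor_le n.+1.
apply: (@squeeze_cvge _ _ _ _ (fun=> 0%E) _ (fun r => (K * r)%:E)).
- near=> r; have r0 : 0 < r by near: r; exact: nbhs_right_gt.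
  apply/andP; split.
    apply: mule_ge0; first by rewrite lee_fin invr_ge0 exprn_ge0// ltW.
    by apply: integral_ge0 => x _; rewrite lee_fin sqr_ge0.
  apply: (@le_trans _ _ ((r ^- n)%:E * (K * r ^+ n.+1)%:E)%E).
    by rewrite lee_wpmul2l ?HK// lee_fin invr_ge0 exprn_ge0 ?ltW.
  rewrite -EFinM lee_fin exprS; have : r ^+ n != 0 by rewrite gt_eqF// exprn_gt0.
  by move: (r ^+ n) => q q0; rewrite (_ : q^-1 * (K * (r * q)) = K * r)//; field.
- exact: cvg_cst.
- apply: cvg_EFin; first by near=> r.
  rewrite -[X in _ --> X](mulr0 K); apply: cvgMr.
  exact: cvg_at_right_filter.
Unshelve. all: by end_near. Qed.

Lemma smooth_spinor : smooth_on_C2 (~` [set 0]) (spinor lam a).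
Proof.
apply: componentwise_spinor => c p b; apply: ck_on_smooth => n.
have o := @open_punctured R.
by apply: ck_onZ => //; exact: ck_on_wave.
Qed.

End Assembly.

(* Nontriviality is asked off the origin: u is determined there, whereas its
   value at the single point 0 carries no information. *)
Theorem theorem1p4 (R : realType) (C : R) (hC : 2^-1 < C) :
  exists u : R * R -> 'cV[R[i]]_2,
    [/\ sobolev_H1_C2 u,
        smooth_on_C2 (~` [set 0]) u,
        exists2 x : R * R, x != 0 & u x != 0,
        vanishes_infinite_order u &
        forall x : R * R, x != 0 ->
          norm_C2 (dirac2 u x) <= C / norm_R2 x * norm_C2 (u x)].
Proof.
have lem : 2^-1 < Num.min C 1 by rewrite lt_min hC /=; lra.
(* The midpoint of [1/2] and [min(C, 1)]. *)
pose a := (2^-1 + Num.min C 1) / 2.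
have mC : Num.min C 1 <= C by rewrite ge_min lexx.
have m1 : Num.min C 1 <= 1 by rewrite ge_min lexx orbT.
have aC : a < C by rewrite /a; lra.
have a12 : 1 / 2 < a by rewrite /a; lra.
have a1 : a < 1 by rewrite /a; lra.
have a01 : 0 <= a < 1 by rewrite a1 andbT; lra.
have [e e0 he] := bump_half a12.
have q0 : 0 < (C ^+ 2 - a ^+ 2) * e ^+ 2 / 48.
  by rewrite divr_gt0// mulr_gt0 ?exprn_gt0// subr_gt0; nra.
(* The largest [lam <= 1] for which the loss [48 lam] of [bump_ineq] is absorbed. *)
pose lam := Num.min 1 ((C ^+ 2 - a ^+ 2) * e ^+ 2 / 48).
have lam01 : 0 < lam <= 1 by rewrite lt_min ltr01 q0 /= ge_min lexx.
have lam01' : 0 <= lam <= 1 by case/andP: lam01 => /ltW -> ->.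
have lamE : 48 * lam <= (C ^+ 2 - a ^+ 2) * e ^+ 2.
  by rewrite -ler_pdivlMl// mulrC ge_min lexx orbT.
exists (spinor lam a); split.
- exact: componentwise_spinor (sobolev_wave lam01 a01).
- exact: smooth_spinor.
- exists (1, 0); last by apply: spinor_neq0 e0 he _ _; rewrite -pair_eqE /= oner_eq0.
  by rewrite -pair_eqE /= oner_eq0.
- exact: vanishes_spinor.
- exact: spinor_dirac_le lam01' a01 (ltW e0) he (ltW aC) lamE.
Qed.
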